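(* The following three integral evaluations hold: $$\int_0^1 y(1-y^2)\, \mathbf{K}^2\left(\sqrt{\frac12 - \frac{y}{2}}\right)\left(2\mathbf{E}(y) - \mathbf{K}(y)\right) dy = \frac{\pi^3(29 + 32\ln 2)}{2048},$$ $$\int_0^1 y(1-y^2)\, \mathbf{K}^2\left(\frac{\sqrt{2 - \sqrt2\sqrt{y^2+1}}}{2}\right)\left(2\mathbf{E}(y) - \mathbf{K}(y)\right) dy = \frac{\pi^2 G}{32\sqrt2} + \frac{7\pi^2}{64\sqrt2} - \frac{9\pi^3}{512\sqrt2} + \frac{\pi^3\ln 2}{128\sqrt2},$$ $$\int_0^1 y(1-y^2)\, \mathbf{K}^2\left(\frac{\sqrt{2 - \sqrt{5-y^2}}}{2}\right)\left(2\mathbf{E}(y) - \mathbf{K}(y)\right) dy = -\frac{57}{64}\pi^2\ln\phi + \frac{\pi^4}{320} + \frac{53\sqrt5\,\pi^2}{256}.$$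
   Context: The complete elliptic integrals of the first and second kind, as functions of the modulus $k$, are $\mathbf{K}(k) = \int_0^{\pi/2} (1 - k^2\sin^2\theta)^{-1/2}\, d\theta$ and $\mathbf{E}(k) = \int_0^{\pi/2} \sqrt{1-k^2\sin^2\theta}\, d\theta$; they depend only on $k^2$, so they are also defined (by the same integrals) when $k$ is purely imaginary, i.e. $k^2<0$. $\mathbf{K}^2(\cdot)$ denotes the square of $\mathbf{K}(\cdot)$. $G = 1 - \frac{1}{3^2} + \frac{1}{5^2} - \cdots$ is Catalan's constant and $\phi = \frac{1+\sqrt5}{2}$ is the golden ratio. *)

(* Defs.v *)
From Stdlib Require Import Reals.
From Coquelicot Require Import Coquelicot.
Open Scope R_scope.

(** The modulus [k] is a complex number, real or purely imaginary, so that
    [k ^ 2] is real and [Re (k ^ 2)] is [k ^ 2] itself.  For other [k] these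
    are not the complex elliptic integrals.  The integrand is continuous when
    [k ^ 2 < 1].  At [k = 1] the integral defining [ellipticK] diverges, and
    there [RInt] gives it an arbitrary real value. *)
Definition ellipticK (k : C) : R :=
  RInt (fun theta => / sqrt (1 - Re (k ^ 2)%C * sin theta ^ 2)) 0 (PI / 2).

Definition ellipticE (k : C) : R :=
  RInt (fun theta => sqrt (1 - Re (k ^ 2)%C * sin theta ^ 2)) 0 (PI / 2).

(** The principal complex square root of a real number: [sqrt] vanishes on
    negative reals, so this is [sqrt x] for [0 <= x] and [i * sqrt (- x)] for
    [x < 0]. *)
Definition sqrtC (x : R) : C := (sqrt x, sqrt (- x)).

Definition catalan : R := Series (fun n => (- 1) ^ n / (2 * INR n + 1) ^ 2).

Definition golden_ratio : R := (1 + sqrt 5) / 2.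

(* Main.v *)
Require Import Defs.
From Stdlib Require Import Reals Lra Lia.
From Coquelicot Require Import Coquelicot.
Open Scope R_scope.

(** Write [a_n = binomial (2 n) n / 4 ^ n] and use the parameter [z = k ^ 2].
    All three integrals are values of one power series.

    On the unit disk [K = PI / 2 * u] with [u z = sum a_n ^ 2 z ^ n] ([is_RInt_K]),
    and Clausen's formula reads [u z ^ 2 = sum a_n ^ 3 (4 z (1 - z)) ^ n]
    ([clausen]).  The three moduli are such that [4 z (1 - z) = x (1 - y ^ 2)] with
    [x = 1], [1 / 2] and [- 1 / 4].  Hence each integral is
    [PI ^ 2 / 4 * sum a_n ^ 3 x ^ n * I_n], where [I_n] is the integral of
    [y (1 - y ^ 2) ^ (n + 1) (2 E (y) - K (y))].  The self-adjoint equation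
    [(z (1 - z) u')' = u / 4] gives by parts a two-term recurrence for the moments of
    [K], and [I_n] becomes a rational function of [n] divided by [a_n ^ 2]
    ([is_RInt_damped_2EK]).  What is left is ([is_RInt_cubic])
    [PI ^ 2 / 4 * sum a_n x ^ n (2 n + 2) ^ 2 / ((2 n + 1) ^ 2 (2 n + 3) (2 n + 5))].

    Partial fractions in [2 n + 1] ([Series_weight]) express this sum by termwise
    primitives of [sum a_n x ^ n = (1 - x) ^ (- 1 / 2)].  All of them are elementary
    but the one with the denominator [(2 n + 1) ^ 2], which is the primitive
    [arcsine_dilog] of [asin t / t] or [arsinh t / t].  Its three values are
    [PI / 2 * ln 2] at [t = 1] and [PI / 8 * ln 2 + catalan / 2] at [t = sin (PI / 4)],
    both by the duplication of the cotangent, and [PI ^ 2 / 20] at [t = 1 / 2] in the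
    hyperbolic case, where [1 / 2 = sinh (ln golden_ratio)] and the classical value of
    the dilogarithm at [/ golden_ratio] intervenes.

    Nearly every identity between functions is proved by checking that a derivative
    vanishes inside an interval and comparing values at an end point
    ([eq_of_derive_zero]).  The end points are often boundary points of a disk of
    convergence; there continuity comes from absolute summability of the
    coefficients ([continuous_cps]). *)

(** * Antiderivatives and sums of functions *)

Lemma eq_of_derive_zero (f : R -> R) (a b : R) :
  a <= b ->
  (forall x, a < x < b -> is_derive f x 0) ->
  (forall x, a <= x <= b -> continuous f x) ->
  f a = f b.
Proof.
intros Hab Hd Hc.
destruct (MVT_gen f a b (fun _ => 0)) as [c [_ Hf]].
- now rewrite Rmin_left, Rmax_right.
- rewrite Rmin_left, Rmax_right by easy.
  intros x Hx; apply continuity_pt_filterlim; now apply Hc.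
- lra.
Qed.

(** The differential equations below are singular at [c]: derivatives come with a
    division by [x - c], while the solutions stay continuous there. *)
Lemma eq_of_derive_zero_punctured (f : R -> R) (a b c : R) :
  a < c < b ->
  continuous f c ->
  (forall x, a < x < b -> x <> c -> is_derive f x 0) ->
  forall x, a < x < b -> f x = f c.
Proof.
intros Hcab Hc Hd x Hx.
assert (Hcont : forall t, a < t < b -> continuous f t).
{ intros t Ht; destruct (Req_dec t c) as [-> | Htc]; [easy |].
  apply (ex_derive_continuous f); exists 0; now apply Hd. }
destruct (Rle_lt_dec x c) as [Hxc | Hxc].
- apply eq_of_derive_zero; [easy | |]; intros t Ht; [apply Hd | apply Hcont]; lra.
- symmetry; apply eq_of_derive_zero; [lra | |]; intros t Ht;
    [apply Hd | apply Hcont]; lra.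
Qed.

(** Splits a goal of continuity along sums and products; what remains is either
    assumed, possibly for every point, or elementary. *)
Ltac continuous_R :=
  lazymatch goal with
  | |- continuous (fun y => @?f y + @?g y) ?x =>
      apply (continuous_plus (V := R_NormedModule) f g x); continuous_R
  | |- continuous (fun y => @?f y - @?g y) ?x =>
      apply (continuous_minus (V := R_NormedModule) f g x); continuous_R
  | |- continuous (fun y => @?f y * @?g y) ?x =>
      apply (continuous_mult (K := R_AbsRing) f g x); continuous_R
  | |- continuous ?f ?x =>
      first
        [ assumption
        | match goal with H : forall t, continuous _ t |- _ => exact (H x) end
        | apply (ex_derive_continuous f); auto_derive; easy
        | idtac ]
  end.

Lemma is_RInt_antiderivative (F f : R -> R) (a b : R) :
  a <= b ->
  (forall x, a < x < b -> is_derive F x (f x)) ->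
  (forall x, a <= x <= b -> continuous F x) ->
  (forall x, continuous f x) ->
  is_RInt f a b (F b - F a).
Proof.
intros Hab HF HcF Hcf.
assert (Hex : forall t, ex_RInt f a t).
{ intros t; apply (ex_RInt_continuous f); intros; apply Hcf. }
assert (Hd : forall t, is_derive (RInt f a) t (f t)).
{ intros t; apply (is_derive_RInt f _ a); [| apply Hcf].
  apply filter_forall; intros s; now apply (RInt_correct f). }
assert (E : RInt f a a - F a = RInt f a b - F b).
{ apply (eq_of_derive_zero (fun t => RInt f a t - F t)); [easy | |].
  - intros t Ht; replace 0 with (f t - f t) by ring.
    apply (is_derive_minus (RInt f a) F); auto.
  - intros t Ht; apply (continuous_minus (RInt f a) F); auto.
    apply (ex_derive_continuous (RInt f a)); eexists; apply Hd. }
rewrite RInt_point in E; unfold zero in E; simpl in E.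
replace (F b - F a) with (RInt f a b) by lra.
now apply (RInt_correct f).
Qed.

Lemma series_tail_bound (s M : nat -> R) (l L : R) (N : nat) :
  is_series s l -> is_series M L -> (forall n, Rabs (s n) <= M n) ->
  Rabs (l - sum_n s N) <= L - sum_n M N.
Proof.
intros Hs HM Hle.
assert (Hpart : forall k,
  Rabs (sum_n s (N + k) - sum_n s N) <= sum_n M (N + k) - sum_n M N).
{ induction k as [| k IH].
  - rewrite Nat.add_0_r; unfold Rminus; rewrite !Rplus_opp_r, Rabs_R0; lra.
  - rewrite Nat.add_succ_r, !sum_Sn; unfold plus; simpl.
    specialize (Hle (S (N + k))).
    replace (sum_n s (N + k) + s (S (N + k)) - sum_n s N)
      with (sum_n s (N + k) - sum_n s N + s (S (N + k))) by ring.
    eapply Rle_trans; [apply Rabs_triang |]; lra. }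
refine (is_lim_seq_le _ _ (Finite (Rabs (l - sum_n s N)))
          (Finite (L - sum_n M N)) Hpart _ _).
- apply (is_lim_seq_abs _ (Finite (l - sum_n s N))).
  apply is_lim_seq_minus'; [| apply is_lim_seq_const].
  apply (is_lim_seq_ext (fun k => sum_n s (k + N)));
    [intros k; now rewrite Nat.add_comm |].
  now apply (is_lim_seq_incr_n (sum_n s) N).
- apply is_lim_seq_minus'; [| apply is_lim_seq_const].
  apply (is_lim_seq_ext (fun k => sum_n M (k + N)));
    [intros k; now rewrite Nat.add_comm |].
  now apply (is_lim_seq_incr_n (sum_n M) N).
Qed.

Lemma tail_eventually_small (M : nat -> R) (L eps : R) :
  is_series M L -> 0 < eps -> eventually (fun N => L - sum_n M N < eps).
Proof.
intros HM Heps.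
destruct (proj2 (is_lim_seq_spec (sum_n M) L) HM (mkposreal eps Heps)) as [N HN].
exists N; intros n Hn; specialize (HN n Hn); simpl in HN.
apply Rabs_lt_between in HN; lra.
Qed.

(** The Weierstrass test gives uniform convergence on the open interval, which
    is all that the Riemann integral sees. *)
Lemma is_RInt_series (g : nat -> R -> R) (f : R -> R) (I M : nat -> R) (a b : R) :
  a < b ->
  (forall n, is_RInt (g n) a b (I n)) ->
  ex_series M ->
  (forall n x, a < x < b -> Rabs (g n x) <= M n) ->
  (forall x, a < x < b -> is_series (fun n => g n x) (f x)) ->
  is_RInt f a b (Series I).
Proof.
intros Hab HI [L HM] Hle Hs.
set (inside x := andb (if Rlt_dec a x then true else false)
                      (if Rlt_dec x b then true else false)).
assert (Hin : forall x, a < x < b -> inside x = true).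
{ intros x Hx; unfold inside; destruct (Rlt_dec a x), (Rlt_dec x b); easy. }
assert (Hout : forall x, inside x = true -> a < x < b).
{ intros x; unfold inside; destruct (Rlt_dec a x), (Rlt_dec x b); easy. }
destruct (filterlim_RInt
   (fun N x => if inside x then sum_n (fun n => g n x) N else 0) a b eventually _
   (fun x => if inside x then f x else 0) (sum_n I)) as [If [HIf Hf]].
- intros N; apply (is_RInt_ext (fun x => sum_n (fun n => g n x) N)).
  + intros x; rewrite Rmin_left, Rmax_right by lra; intros Hx.
    now rewrite Hin.
  + induction N as [| N IH].
    * rewrite sum_O; eapply is_RInt_ext; [| apply (HI 0%nat)].
      intros; now rewrite sum_O.
    * rewrite sum_Sn; eapply is_RInt_ext;
        [| apply (is_RInt_plus (V := R_NormedModule)); [apply IH | apply HI]].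
      intros; now rewrite sum_Sn.
- apply filterlim_locally; intros eps.
  generalize (tail_eventually_small M L eps HM (cond_pos eps)).
  apply filter_imp; intros N HN x; destruct (inside x) eqn:E.
  + apply Hout in E; change (Rabs (sum_n (fun n => g n x) N - f x) < eps).
    rewrite Rabs_minus_sym.
    apply Rle_lt_trans with (2 := HN); apply series_tail_bound; auto.
  + apply ball_center.
- rewrite (is_series_unique I If HIf).
  eapply is_RInt_ext; [| apply Hf].
  intros x; rewrite Rmin_left, Rmax_right by lra; intros Hx; simpl.
  now rewrite Hin.
Qed.

(** * Power series of radius at least one *)

Definition unit_radius (c : nat -> R) : Prop := Rbar_le 1 (CV_radius c).

Lemma unit_radius_inside c x :
  unit_radius c -> Rabs x < 1 -> Rbar_lt (Rabs x) (CV_radius c).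
Proof. intros Hc Hx; now apply Rbar_lt_le_trans with 1. Qed.

Lemma unit_radius_ex_pseries c x :
  unit_radius c -> Rabs x < 1 -> ex_pseries c x.
Proof. intros; apply CV_radius_inside; now apply unit_radius_inside. Qed.

Lemma unit_radius_is_series c x :
  unit_radius c -> Rabs x < 1 ->
  is_series (fun n => c n * x ^ n) (PSeries c x).
Proof.
intros Hc Hx; apply Series_correct.
now apply ex_pseries_R, unit_radius_ex_pseries.
Qed.

Lemma unit_radius_continuous c x :
  unit_radius c -> Rabs x < 1 -> continuous (PSeries c) x.
Proof.
intros; apply continuity_pt_filterlim, PSeries_continuity.
now apply unit_radius_inside.
Qed.

Lemma unit_radius_of_bound c B : (forall n, Rabs (c n) <= B) -> unit_radius c.
Proof.
intros H; apply (proj1 (CV_radius_bounded c)).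
exists B; intros n; rewrite pow1, Rmult_1_r; apply H.
Qed.

Lemma unit_radius_scal p c : unit_radius c -> unit_radius (fun n => p * c n).
Proof.
intros Hc; apply Rbar_le_trans with (1 := Hc).
apply (proj2 (CV_radius_bounded c)); intros r [M HM].
apply (proj1 (CV_radius_bounded (fun n => p * c n))).
exists (Rabs p * M); intros n; rewrite Rmult_assoc, Rabs_mult.
apply Rmult_le_compat_l; [apply Rabs_pos | apply HM].
Qed.

Lemma unit_radius_plus c d :
  unit_radius c -> unit_radius d -> unit_radius (fun n => c n + d n).
Proof.
intros Hc Hd; apply Rbar_le_trans with (2 := CV_radius_plus c d).
now apply Rbar_min_case.
Qed.

(** The coefficients of [x F'(x)], for [F] the power series of [c]. *)
Definition euler (c : nat -> R) (n : nat) : R := INR n * c n.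

Lemma unit_radius_euler c : unit_radius c -> unit_radius (euler c).
Proof.
unfold unit_radius; rewrite <- (CV_radius_derive c), <- CV_radius_incr_1.
intros H; rewrite (CV_radius_ext _ (PS_incr_1 (PS_derive c))); [easy |].
intros [| n]; unfold euler, PS_derive; simpl PS_incr_1; [| easy].
simpl; now rewrite Rmult_0_l.
Qed.

Lemma is_derive_PSeries_euler c x :
  unit_radius c -> Rabs x < 1 -> x <> 0 ->
  is_derive (PSeries c) x (PSeries (euler c) x / x).
Proof.
intros Hc Hx Hx0.
replace (PSeries (euler c) x / x) with (PSeries (PS_derive c) x).
- apply is_derive_PSeries; now apply unit_radius_inside.
- rewrite (PSeries_ext (euler c) (PS_incr_1 (PS_derive c))).
  + rewrite PSeries_incr_1; now field.
  + intros [| n]; unfold euler, PS_derive; simpl PS_incr_1; [| easy].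
    simpl; now rewrite Rmult_0_l.
Qed.

Definition backward_diff (c : nat -> R) (n : nat) : R :=
  match n with 0%nat => c 0%nat | S m => c (S m) - c m end.

Lemma unit_radius_backward_diff c :
  (forall n, 0 <= c n <= 1) -> unit_radius (backward_diff c).
Proof.
intros Hc; apply unit_radius_of_bound with 1; intros [| n]; simpl; apply Rabs_le.
- specialize (Hc 0%nat); lra.
- generalize (Hc n) (Hc (S n)); lra.
Qed.

Lemma PSeries_backward_diff c x :
  unit_radius c -> Rabs x < 1 ->
  (1 - x) * PSeries c x = PSeries (backward_diff c) x.
Proof.
intros Hc Hx.
rewrite (PSeries_ext (backward_diff c) (PS_minus c (PS_incr_1 c))).
- rewrite PSeries_minus, PSeries_incr_1; [ring | |].
  + now apply unit_radius_ex_pseries.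
  + apply ex_pseries_incr_1; now apply unit_radius_ex_pseries.
- intros [| n]; unfold PS_minus, PS_incr_1, plus, opp, zero; simpl; ring.
Qed.

Lemma sum_backward_diff c N : sum_n (backward_diff c) N = c N.
Proof.
induction N as [| N IH]; [now rewrite sum_O |].
rewrite sum_Sn, IH; unfold plus; simpl; ring.
Qed.

Lemma Rabs_lt_1 x : -1 < x < 1 -> Rabs x < 1.
Proof. intros; apply Rabs_def1; lra. Qed.

Definition clamp (x : R) : R := Rmax (-1) (Rmin x 1).

Lemma clamp_id x : -1 <= x <= 1 -> clamp x = x.
Proof. intros; unfold clamp; rewrite Rmin_left, Rmax_right; lra. Qed.

Lemma clamp_bound x : -1 <= clamp x <= 1.
Proof.
unfold clamp; split; [apply Rmax_l |].
apply Rmax_lub; [lra | apply Rmin_r].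
Qed.

Lemma continuous_clamp x : continuous clamp x.
Proof.
apply (continuous_ext (fun x => (Rabs (x + 1) - Rabs (x - 1)) / 2)).
- intros y; unfold clamp, Rmax, Rmin.
  destruct (Rle_dec y 1); destruct (Rle_dec _ _);
  unfold Rabs; destruct (Rcase_abs (y + 1)), (Rcase_abs (y - 1)); lra.
- apply (continuous_mult (fun x => Rabs (x + 1) - Rabs (x - 1)) (fun _ => / 2));
    [| apply continuous_const].
  apply (continuous_minus (fun x => Rabs (x + 1)) (fun x => Rabs (x - 1))).
  + apply continuous_comp; [| apply continuous_Rabs].
    apply (ex_derive_continuous (fun x => x + 1)); auto_derive; easy.
  + apply continuous_comp; [| apply continuous_Rabs].
    apply (ex_derive_continuous (fun x => x - 1)); auto_derive; easy.
Qed.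

(** When the coefficients are absolutely summable, extending the power series
    by constants beyond [[-1, 1]] makes it continuous on the whole line.  This
    turns every limit at [1] (Abel's theorem) into plain continuity. *)
Definition cps (c : nat -> R) (x : R) : R := PSeries c (clamp x).

Definition abs_summable (c : nat -> R) : Prop := ex_series (fun n => Rabs (c n)).

Lemma Rabs_mult_pow_le (c x : R) (n : nat) :
  -1 <= x <= 1 -> Rabs (c * x ^ n) <= Rabs c.
Proof.
intros Hx; rewrite Rabs_mult, <- RPow_abs.
rewrite <- (Rmult_1_r (Rabs c)) at 2.
apply Rmult_le_compat_l; [apply Rabs_pos |].
rewrite <- (pow1 n); apply pow_incr; split; [apply Rabs_pos |].
apply Rabs_le; lra.
Qed.

Lemma cps_is_series c x :
  abs_summable c -> -1 <= x <= 1 -> is_series (fun n => c n * x ^ n) (cps c x).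
Proof.
intros Hc Hx; unfold cps; rewrite clamp_id by easy; apply Series_correct.
apply ex_series_Rabs, (ex_series_le (K := R_AbsRing) (V := R_CompleteNormedModule) _ (fun n => Rabs (c n))); [| easy].
intros n; unfold norm; simpl; unfold abs; simpl; rewrite Rabs_Rabsolu.
now apply Rabs_mult_pow_le.
Qed.

Lemma continuous_cps c x : abs_summable c -> continuous (cps c) x.
Proof.
intros Hc; generalize (Series_correct _ Hc); set (L := Series _); intros HL.
apply filterlim_locally; intros eps.
assert (He : 0 < eps / 3) by (generalize (cond_pos eps); lra).
destruct (tail_eventually_small _ _ _ HL He) as [N HN].
specialize (HN N (Nat.le_refl N)).
set (p y := sum_n (fun n => c n * clamp y ^ n) N).
assert (Hp : continuous p x).
{ unfold p; clear; induction N as [| N IH].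
  - apply (continuous_ext (fun _ => c 0%nat)); [| apply continuous_const].
    intros y; rewrite sum_O; simpl; ring.
  - apply (continuous_ext (fun y => plus (sum_n (fun n => c n * clamp y ^ n) N)
                                      (c (S N) * clamp y ^ S N))).
    + intros y; now rewrite sum_Sn.
    + apply (continuous_plus (V := R_NormedModule)); [apply IH |].
      apply (continuous_mult (fun _ => c (S N)) (fun y => clamp y ^ S N));
        [apply continuous_const |].
      apply (continuous_comp clamp (fun y => y ^ S N)); [apply continuous_clamp |].
      apply (ex_derive_continuous (fun y => y ^ S N)); auto_derive; easy. }
assert (Hb : forall y, Rabs (cps c y - p y) < eps / 3).
{ intros y; eapply Rle_lt_trans with (2 := HN).
  replace (cps c y) with (cps c (clamp y)).
  - apply series_tail_bound; [| easy |].
    + apply cps_is_series; [easy | apply clamp_bound].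
    + intros n; apply Rabs_mult_pow_le, clamp_bound.
  - unfold cps; now rewrite (clamp_id (clamp y)) by apply clamp_bound. }
generalize (proj1 (filterlim_locally p (p x)) Hp (mkposreal _ He)).
apply filter_imp; intros y Hy.
change (Rabs (p y - p x) < eps / 3) in Hy.
change (Rabs (cps c y - cps c x) < eps).
replace (cps c y - cps c x)
  with ((cps c y - p y) + ((p y - p x) + (p x - cps c x))) by ring.
generalize (Hb y) (Hb x); rewrite (Rabs_minus_sym (cps c x) (p x)); intros H1 H2.
eapply Rle_lt_trans; [apply Rabs_triang |].
eapply Rle_lt_trans; [apply Rplus_le_compat_l, Rabs_triang |]; lra.
Qed.

Lemma cps_eq c x : -1 < x < 1 -> cps c x = PSeries c x.
Proof. intros; unfold cps; rewrite clamp_id; lra. Qed.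

Lemma locally_between (a b x : R) :
  a < x < b -> locally x (fun y => a < y < b).
Proof.
intros Hx; apply (locally_interval _ x a b); simpl; try lra.
intros y H1 H2; simpl in *; lra.
Qed.

Lemma is_derive_cps_euler c x :
  unit_radius c -> -1 < x < 1 -> x <> 0 ->
  is_derive (cps c) x (PSeries (euler c) x / x).
Proof.
intros Hc Hx Hx0.
apply (is_derive_ext_loc (PSeries c)).
- apply (filter_imp (fun y => -1 < y < 1)); [| now apply locally_between].
  intros y Hy; now rewrite cps_eq.
- apply is_derive_PSeries_euler; auto using Rabs_lt_1.
Qed.

(** Integrating [t^(j-1) * sum_n c_n (eps t^m)^n] term by term divides [c_n] by
    [m n + j].  Iterating this from a geometric or binomial series produces
    logarithms, inverse trigonometric functions and dilogarithms. *)
Definition integrated (m j : nat) (c : nat -> R) (n : nat) : R :=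
  c n / (INR m * INR n + INR j).

Lemma unit_radius_integrated m j c :
  unit_radius c -> (1 <= m)%nat -> (1 <= j)%nat -> unit_radius (integrated m j c).
Proof.
intros Hc Hm Hj; red.
apply Rbar_le_trans with (1 := Hc).
apply (proj2 (CV_radius_bounded c)); intros r [M HM].
apply (proj1 (CV_radius_bounded (integrated m j c))).
exists M; intros n; apply Rle_trans with (2 := HM n).
apply le_INR in Hm, Hj; simpl in Hm, Hj; assert (Hn := pos_INR n).
assert (1 <= INR m * INR n + INR j) by nra.
unfold integrated, Rdiv; rewrite !Rabs_mult, (Rabs_pos_eq (/ _)).
- rewrite <- (Rmult_1_r (Rabs (c n))) at 2.
  apply Rmult_le_compat_r; [apply Rabs_pos |].
  apply Rmult_le_compat_l; [apply Rabs_pos |].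
  rewrite <- Rinv_1; apply Rinv_le_contravar; lra.
- apply Rlt_le, Rinv_0_lt_compat; lra.
Qed.

Lemma is_derive_integrated (m j : nat) (c : nat -> R) (eps t : R) :
  unit_radius c -> (1 <= m)%nat -> (1 <= j)%nat ->
  eps <> 0 -> t <> 0 -> -1 < eps * t ^ m < 1 ->
  is_derive (fun s => s ^ j * cps (integrated m j c) (eps * s ^ m)) t
    (t ^ (j - 1) * PSeries c (eps * t ^ m)).
Proof.
intros Hc Hm Hj He Ht Hx.
assert (Hci := unit_radius_integrated m j c Hc Hm Hj).
assert (Htm : t ^ m <> 0) by now apply pow_nonzero.
assert (Hx0 : eps * t ^ m <> 0) by (now apply Rmult_integral_contrapositive).
assert (HD := is_derive_cps_euler _ _ Hci Hx Hx0).
set (x := eps * t ^ m) in *.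
assert (E : INR j * PSeries (integrated m j c) x
            + INR m * PSeries (euler (integrated m j c)) x = PSeries c x).
{ assert (Hx1 := Rabs_lt_1 x Hx).
  rewrite <- !PSeries_scal, <- PSeries_plus.
  - apply PSeries_ext; intros n.
    apply le_INR in Hm, Hj; simpl in Hm, Hj; assert (Hn := pos_INR n).
    unfold PS_plus, PS_scal, plus, scal, euler, integrated; simpl; unfold mult; simpl.
    field; nra.
  - apply (ex_pseries_scal (V := R_NormedModule)); [apply Rmult_comm |]; now apply unit_radius_ex_pseries.
  - apply (ex_pseries_scal (V := R_NormedModule)); [apply Rmult_comm |]; apply unit_radius_ex_pseries; auto using unit_radius_euler. }
rewrite <- (cps_eq (integrated m j c) x) in E by easy.
assert (Hpow : forall k, is_derive (fun s => s ^ k) t (INR k * t ^ pred k)).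
{ intros k; auto_derive; [easy | ring]. }
assert (Hd : is_derive (fun s => s ^ j * cps (integrated m j c) (eps * s ^ m)) t
  (INR j * t ^ pred j * cps (integrated m j c) x
   + t ^ j * (eps * (INR m * t ^ pred m)
              * (PSeries (euler (integrated m j c)) x / x)))).
{ apply (is_derive_mult (fun s => s ^ j)
           (fun s => cps (integrated m j c) (eps * s ^ m))); [apply Hpow | |].
  - apply (is_derive_comp (cps (integrated m j c)) (fun s => eps * s ^ m));
      [exact HD |].
    apply (is_derive_scal (fun s => s ^ m)), Hpow.
  - exact Rmult_comm. }
replace (t ^ (j - 1) * PSeries c x)
  with (INR j * t ^ pred j * cps (integrated m j c) x
   + t ^ j * (eps * (INR m * t ^ pred m)
              * (PSeries (euler (integrated m j c)) x / x))); [exact Hd |].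
rewrite <- E.
destruct j as [| j]; [lia |]; destruct m as [| m]; [lia |].
simpl pred; replace (S j - 1)%nat with j by lia.
unfold x; change (t ^ S m) with (t * t ^ m); change (t ^ S j) with (t * t ^ j).
field; repeat split; try easy.
now apply pow_nonzero.
Qed.

Lemma abs_summable_le (c d : nat -> R) :
  (forall n, Rabs (c n) <= d n) -> ex_series d -> abs_summable c.
Proof.
intros H Hd.
apply (ex_series_le (K := R_AbsRing) (V := R_CompleteNormedModule) _ d); [| easy].
intros n; unfold norm; simpl; unfold abs; simpl; now rewrite Rabs_Rabsolu.
Qed.

(** With Abel's summation this is what makes [(1 - x) * sum c_n x ^ n] extend
    continuously to [x = 1], with the limit of [c] as value. *)
Lemma abs_summable_backward_diff c (s l : R) :
  s = 1 \/ s = -1 ->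
  (forall n, 0 <= s * (c (S n) - c n)) -> is_lim_seq c l ->
  abs_summable (backward_diff c).
Proof.
intros Hs Hmon Hl; exists (Rabs (c 0%nat) + s * (l - c 0%nat)).
change (is_lim_seq (sum_n (fun n => Rabs (backward_diff c n)))
          (Rabs (c 0%nat) + s * (l - c 0%nat))).
apply (is_lim_seq_ext (fun N => Rabs (c 0%nat) + s * (c N - c 0%nat))).
- induction n as [| n IH]; [rewrite sum_O; simpl; ring |].
  rewrite sum_Sn, <- IH; unfold plus; simpl.
  replace (Rabs (c (S n) - c n)) with (s * (c (S n) - c n)); [ring |].
  specialize (Hmon n).
  destruct Hs as [-> | ->]; [rewrite Rabs_pos_eq | rewrite Rabs_left1]; lra.
- apply is_lim_seq_plus'; [apply is_lim_seq_const |].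
  apply (is_lim_seq_scal_l _ s (Finite (l - c 0%nat))).
  apply is_lim_seq_minus'; [easy | apply is_lim_seq_const].
Qed.

Lemma cps_backward_diff_1 c (l : R) :
  is_lim_seq c l -> cps (backward_diff c) 1 = l.
Proof.
intros Hl; unfold cps; rewrite clamp_id by lra.
apply is_series_unique.
apply (is_series_ext (backward_diff c)); [intros n; now rewrite pow1, Rmult_1_r |].
change (is_lim_seq (sum_n (backward_diff c)) l).
apply (is_lim_seq_ext c); [| easy].
intros n; now rewrite sum_backward_diff.
Qed.

Lemma PSeries_shift c x :
  unit_radius c -> Rabs x < 1 ->
  PSeries c x = c 0%nat + x * PSeries (fun n => c (S n)) x.
Proof. intros; apply PSeries_decr_1; now apply unit_radius_ex_pseries. Qed.

Lemma PSeries_comb3 (c d e : nat -> R) (p q r x : R) :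
  unit_radius c -> unit_radius d -> unit_radius e -> Rabs x < 1 ->
  PSeries (fun n => p * c n + q * d n + r * e n) x
  = p * PSeries c x + q * PSeries d x + r * PSeries e x.
Proof.
intros Hc Hd He Hx; unfold PSeries at 1; apply is_series_unique.
apply (is_series_ext
  (fun n => plus (plus (scal p (c n * x ^ n)) (scal q (d n * x ^ n)))
                 (scal r (e n * x ^ n)))).
- intros n; unfold plus, scal; simpl; unfold mult; simpl; ring.
- repeat apply (is_series_plus (V := R_NormedModule));
    apply (is_series_scal (V := R_NormedModule)); now apply unit_radius_is_series.
Qed.

Lemma PSeries_comb2 (c d : nat -> R) (p q x : R) :
  unit_radius c -> unit_radius d -> Rabs x < 1 ->
  PSeries (fun n => p * c n + q * d n) x = p * PSeries c x + q * PSeries d x.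
Proof.
intros Hc Hd Hx.
rewrite (PSeries_ext _ (fun n => p * c n + q * d n + 0 * d n)) by (intros; ring).
rewrite PSeries_comb3 by easy; ring.
Qed.

(** * Termwise primitives *)

Definition series_primitive (m j : nat) (c : nat -> R) (eps t : R) : R :=
  t ^ j * cps (integrated m j c) (eps * t ^ m).

Lemma continuous_series_primitive m j c eps t :
  abs_summable (integrated m j c) -> continuous (series_primitive m j c eps) t.
Proof.
intros Hc; apply (continuous_mult (fun s => s ^ j)
  (fun s => cps (integrated m j c) (eps * s ^ m))).
- apply (ex_derive_continuous (fun s => s ^ j)); auto_derive; easy.
- apply (continuous_comp (fun s => eps * s ^ m) (cps (integrated m j c)));
    [| now apply continuous_cps].
  apply (ex_derive_continuous (fun s => eps * s ^ m)); auto_derive; easy.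
Qed.

Lemma continuous_series_primitive_inside m j c eps t :
  unit_radius c -> (1 <= m)%nat -> (1 <= j)%nat -> -1 < eps * t ^ m < 1 ->
  continuous (series_primitive m j c eps) t.
Proof.
intros Hc Hm Hj Ht; apply (continuous_mult (fun s => s ^ j)
  (fun s => cps (integrated m j c) (eps * s ^ m))).
- apply (ex_derive_continuous (fun s => s ^ j)); auto_derive; easy.
- apply (continuous_comp (fun s => eps * s ^ m) (cps (integrated m j c))).
  + apply (ex_derive_continuous (fun s => eps * s ^ m)); auto_derive; easy.
  + apply (continuous_ext_loc _ (PSeries (integrated m j c))).
    * apply (filter_imp (fun y => -1 < y < 1)); [| now apply locally_between].
      intros y Hy; now rewrite cps_eq.
    * apply unit_radius_continuous; [now apply unit_radius_integrated |].
      now apply Rabs_lt_1.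
Qed.

Lemma series_primitive_0 m j c eps : (1 <= j)%nat -> series_primitive m j c eps 0 = 0.
Proof. intros; unfold series_primitive; rewrite pow_i by lia; ring. Qed.

(** Recognizes a termwise primitive after a substitution [t = s x]: both sides
    vanish at [0] and have the same derivative.  Only continuity is asked at [b],
    where [s b] may lie on the boundary of the disk. *)
Lemma series_primitive_closed_form (m j : nat) (c : nat -> R) (eps : R)
    (s ds G : R -> R) (b : R) :
  unit_radius c -> (1 <= m)%nat -> (1 <= j)%nat -> eps <> 0 -> 0 <= b ->
  s 0 = 0 -> G 0 = 0 ->
  (forall x, 0 <= x <= b -> is_derive s x (ds x)) ->
  (forall x, 0 <= x <= b -> continuous G x) ->
  (forall x, 0 <= x <= b -> continuous (series_primitive m j c eps) (s x)) ->
  (forall x, 0 < x < b -> s x <> 0 /\ -1 < eps * s x ^ m < 1 /\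
     is_derive G x (s x ^ (j - 1) * PSeries c (eps * s x ^ m) * ds x)) ->
  series_primitive m j c eps (s b) = G b.
Proof.
intros Hc Hm Hj He Hb Hs0 HG0 Hs HGc Hpc Hd.
cut (series_primitive m j c eps (s 0) - G 0 = series_primitive m j c eps (s b) - G b).
{ rewrite Hs0, HG0, series_primitive_0 by easy; lra. }
apply (eq_of_derive_zero (fun x => series_primitive m j c eps (s x) - G x)); [easy | |].
- intros x Hx; destruct (Hd x Hx) as (H1 & H2 & H3).
  set (v := s x ^ (j - 1) * PSeries c (eps * s x ^ m)) in H3.
  replace 0 with (ds x * v - v * ds x) by ring.
  apply (is_derive_minus (fun x => series_primitive m j c eps (s x)) G); [| easy].
  apply (is_derive_comp (series_primitive m j c eps) s); [| apply Hs; lra].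
  now apply is_derive_integrated.
- intros x Hx.
  apply (continuous_minus (fun x => series_primitive m j c eps (s x)) G); [| auto].
  apply (continuous_comp s); [| auto].
  apply (ex_derive_continuous s); eexists; auto.
Qed.

(** * Normalized central binomial coefficients *)

(** [cbin n] is [binomial (2 n) n / 4 ^ n]. *)
Fixpoint cbin (n : nat) : R :=
  match n with
  | 0%nat => 1
  | S m => cbin m * ((2 * INR m + 1) / (2 * INR m + 2))
  end.

Lemma cbin_S n : cbin (S n) = cbin n * ((2 * INR n + 1) / (2 * INR n + 2)).
Proof. easy. Qed.

Lemma cbin_bounds n : 0 < cbin n <= 1.
Proof.
induction n as [| n IH]; [simpl; lra |].
rewrite cbin_S; assert (Hn := pos_INR n).
assert (0 < (2 * INR n + 1) / (2 * INR n + 2)).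
{ apply Rdiv_lt_0_compat; lra. }
assert ((2 * INR n + 1) / (2 * INR n + 2) <= 1).
{ apply Rmult_le_reg_r with (2 * INR n + 2); [lra |].
  unfold Rdiv; rewrite Rmult_assoc, Rinv_l by lra; lra. }
nra.
Qed.

Lemma cbin_decr n : cbin n - cbin (S n) = cbin n / (2 * INR n + 2).
Proof. rewrite cbin_S; assert (Hn := pos_INR n); field; lra. Qed.

Lemma cbin_sqr_le n : cbin n ^ 2 <= / (INR n + 1).
Proof.
induction n as [| n IH].
- simpl; rewrite Rplus_0_l, Rinv_1; lra.
- rewrite cbin_S, S_INR; assert (Hn := pos_INR n).
  rewrite Rpow_mult_distr.
  apply Rle_trans with (/ (INR n + 1) * ((2 * INR n + 1) / (2 * INR n + 2)) ^ 2).
  + apply Rmult_le_compat_r; [apply pow2_ge_0 | easy].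
  + apply Rminus_le_0.
    replace (_ - _) with ((3 * INR n + 2) / (4 * (INR n + 1) ^ 3 * (INR n + 2)))
      by (field; lra).
    apply Rlt_le, Rdiv_lt_0_compat; [lra |].
    apply Rmult_lt_0_compat; [| lra].
    apply Rmult_lt_0_compat; [lra | apply pow_lt; lra].
Qed.

(** The terms are dominated by the telescoping differences
    [2 * (cbin n - cbin (n + 1))].  This gives convergence of the primitives of the
    binomial series at the boundary of the disk. *)
Lemma ex_series_cbin : ex_series (fun n => cbin n / (2 * INR n + 1)).
Proof.
destruct (ex_finite_lim_seq_decr cbin 0) as [l Hl].
- intros n; generalize (cbin_decr n) (cbin_bounds n) (pos_INR n); intros H1 H2 H3.
  assert (0 <= cbin n / (2 * INR n + 2)) by (apply Rlt_le, Rdiv_lt_0_compat; lra).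
  lra.
- intros n; generalize (cbin_bounds n); lra.
- apply (abs_summable_backward_diff cbin (-1) l) in Hl; [| now right |].
  + unfold abs_summable in Hl; apply ex_series_incr_1 in Hl.
    apply (ex_series_scal (V := R_NormedModule) 2) in Hl.
    apply (ex_series_le (K := R_AbsRing) (V := R_CompleteNormedModule)) with (2 := Hl).
    intros n; unfold norm, scal; simpl; unfold abs, mult; simpl backward_diff.
    rewrite Rabs_minus_sym, cbin_decr.
    generalize (cbin_bounds n) (pos_INR n); intros H2 H3; simpl.
    assert (0 < cbin n / (2 * INR n + 2)) by (apply Rdiv_lt_0_compat; lra).
    assert (0 < cbin n / (2 * INR n + 1)) by (apply Rdiv_lt_0_compat; lra).
    rewrite !Rabs_pos_eq by lra.
    apply Rminus_le_0.
    replace (_ - _) with (2 * INR n * cbin n / ((2 * INR n + 1) * (2 * INR n + 2)))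
      by (field; lra).
    apply Rdiv_le_0_compat; nra.
  + intros n; generalize (cbin_decr n) (cbin_bounds n) (pos_INR n); intros H1 H2 H3.
    assert (0 <= cbin n / (2 * INR n + 2)) by (apply Rlt_le, Rdiv_lt_0_compat; lra).
    lra.
Qed.

Lemma unit_radius_cbin : unit_radius cbin.
Proof.
apply unit_radius_of_bound with 1; intros n; generalize (cbin_bounds n).
intros; rewrite Rabs_pos_eq; lra.
Qed.

(** The recurrence of [cbin] is the equation [(1 - x) F' = F / 2]. *)
Lemma PSeries_cbin x : Rabs x < 1 -> PSeries cbin x = / sqrt (1 - x).
Proof.
intros Hx.
assert (Hode : forall y, Rabs y < 1 ->
  (1 - y) * PSeries (euler cbin) y = y / 2 * PSeries cbin y).
{ intros y Hy.
  cut (PSeries (euler cbin) y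
       = y * (1 * PSeries (euler cbin) y + / 2 * PSeries cbin y)); [lra |].
  rewrite <- PSeries_comb2;
    [| apply unit_radius_euler | |]; try apply unit_radius_cbin; [| easy].
  rewrite PSeries_shift; [| apply unit_radius_euler, unit_radius_cbin | easy].
  rewrite (PSeries_ext _ (fun n => 1 * euler cbin n + / 2 * cbin n)).
  - unfold euler at 1; simpl; ring.
  - intros n; unfold euler; rewrite cbin_S, S_INR; assert (Hn := pos_INR n).
    field; lra. }
cut (PSeries cbin x * sqrt (1 - x) = 1).
{ intros H; apply Rmult_eq_reg_r with (sqrt (1 - x)).
  - rewrite H, Rinv_l; [easy |]; intros E; rewrite E in H; lra.
  - intros E; rewrite E in H; lra. }
apply Rabs_lt_between in Hx.
rewrite (eq_of_derive_zero_punctured (fun y => PSeries cbin y * sqrt (1 - y)) (-1) 1 0);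
  [| lra | | | easy].
- rewrite PSeries_0, Rminus_0_r, sqrt_1; simpl; ring.
- apply (continuous_mult (PSeries cbin) (fun y => sqrt (1 - y))).
  + apply unit_radius_continuous; [apply unit_radius_cbin |].
    rewrite Rabs_R0; lra.
  + apply (ex_derive_continuous (fun y => sqrt (1 - y))); auto_derive; lra.
- intros y Hy Hy0.
  assert (Hs : 0 < sqrt (1 - y)) by (apply sqrt_lt_R0; lra).
  assert (Hss : sqrt (1 - y) * sqrt (1 - y) = 1 - y) by (apply sqrt_sqrt; lra).
  assert (E := Hode y (Rabs_lt_1 y Hy)).
  replace 0 with (PSeries (euler cbin) y / y * sqrt (1 - y)
                  + PSeries cbin y * (- / (2 * sqrt (1 - y)))).
  + apply (is_derive_mult (PSeries cbin) (fun y => sqrt (1 - y))); [| | exact Rmult_comm].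
    * apply is_derive_PSeries_euler; [apply unit_radius_cbin | | easy].
      now apply Rabs_lt_1.
    * auto_derive; [lra |]; change (1 + - y) with (1 - y); field; lra.
  + apply Rmult_eq_reg_r with (2 * y * sqrt (1 - y)); [| nra].
    transitivity (2 * (sqrt (1 - y) * sqrt (1 - y) * PSeries (euler cbin) y)
                  - y * PSeries cbin y); [field; lra |].
    rewrite Hss, E; field.
Qed.

Lemma PSeries_geom x : Rabs x < 1 -> PSeries (fun _ => 1) x = / (1 - x).
Proof.
intros Hx; apply is_series_unique.
apply (is_series_ext (fun n => x ^ n)); [intros; symmetry; apply Rmult_1_l |].
now apply is_series_geom.
Qed.

Lemma unit_radius_geom : unit_radius (fun _ => 1).
Proof. apply unit_radius_of_bound with 1; intros; rewrite Rabs_R1; lra. Qed.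

(** * Wallis integrals *)

Lemma wallis_step n I :
  is_RInt (fun t => sin t ^ n) 0 (PI / 2) I ->
  is_RInt (fun t => sin t ^ (n + 2)) 0 (PI / 2) ((INR n + 1) / (INR n + 2) * I).
Proof.
intros HI; assert (Hn := pos_INR n).
assert (Hd : is_RInt (fun t => (INR n + 2) * sin t ^ (n + 2) - (INR n + 1) * sin t ^ n)
               0 (PI / 2) 0).
{ replace 0 with (- cos (PI / 2) * sin (PI / 2) ^ (n + 1) - - cos 0 * sin 0 ^ (n + 1)) at 2
    by (rewrite cos_PI2, sin_0, pow_i by lia; ring).
  apply (is_RInt_derive (fun t => - cos t * sin t ^ (n + 1))).
  - intros t _; auto_derive; [easy |].
    rewrite plus_INR, !pow_add; simpl INR; replace (pred (n + 1)) with n by lia.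
    assert (E : cos t ^ 2 = 1 - sin t ^ 2)
      by (generalize (sin2_cos2 t); unfold Rsqr; intros; lra).
    transitivity (sin t * (sin t ^ n * sin t ^ 1) - (INR n + 1) * sin t ^ n * cos t ^ 2);
      [ring | rewrite E; ring].
  - intros t _; apply (ex_derive_continuous
      (fun t => (INR n + 2) * sin t ^ (n + 2) - (INR n + 1) * sin t ^ n)).
    auto_derive; easy. }
assert (H := is_RInt_scal _ _ _ (/ (INR n + 2)) _
               (is_RInt_plus _ _ _ _ _ _ Hd (is_RInt_scal _ _ _ (INR n + 1) _ HI))).
unfold plus, scal in H; simpl in H; unfold mult in H; simpl in H.
replace ((INR n + 1) / (INR n + 2) * I)
  with (/ (INR n + 2) * (0 + (INR n + 1) * I)) by (field; lra).
eapply is_RInt_ext; [| apply H].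
intros t _; simpl; field; lra.
Qed.

Lemma wallis_even n :
  is_RInt (fun t => sin t ^ (2 * n)) 0 (PI / 2) (PI / 2 * cbin n).
Proof.
induction n as [| n IH].
- simpl; replace (PI / 2 * 1) with (scal (PI / 2 - 0) 1)
    by (unfold scal; simpl; unfold mult; simpl; ring).
  apply (is_RInt_const (V := R_NormedModule)).
- apply wallis_step in IH; rewrite mult_INR in IH; simpl INR in IH.
  replace (2 * S n)%nat with (2 * n + 2)%nat by lia.
  replace (PI / 2 * cbin (S n))
    with ((2 * INR n + 1) / (2 * INR n + 2) * (PI / 2 * cbin n)); [easy |].
  rewrite cbin_S; ring.
Qed.

Lemma wallis_odd n :
  is_RInt (fun t => sin t ^ (2 * n + 1)) 0 (PI / 2) (/ ((2 * INR n + 1) * cbin n)).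
Proof.
induction n as [| n IH].
- replace (/ _) with (- cos (PI / 2) - - cos 0)
    by (rewrite cos_PI2, cos_0; simpl; field).
  apply (is_RInt_derive (fun t => - cos t)).
  + intros t _; auto_derive; [easy | simpl; ring].
  + intros t _; apply (ex_derive_continuous (fun t => sin t ^ (2 * 0 + 1))).
    auto_derive; easy.
- apply wallis_step in IH; rewrite plus_INR, mult_INR in IH; simpl INR in IH.
  replace (2 * S n + 1)%nat with (2 * n + 1 + 2)%nat by lia.
  replace (/ ((2 * INR (S n) + 1) * cbin (S n)))
    with ((2 * INR n + 1 + 1) / (2 * INR n + 1 + 2) * / ((2 * INR n + 1) * cbin n));
    [easy |].
  rewrite cbin_S, S_INR; generalize (pos_INR n) (cbin_bounds n); intros.
  field; lra.
Qed.

Lemma wallis_le m n I J :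
  (m <= n)%nat ->
  is_RInt (fun t => sin t ^ m) 0 (PI / 2) I ->
  is_RInt (fun t => sin t ^ n) 0 (PI / 2) J -> J <= I.
Proof.
intros Hmn HI HJ; assert (HPI := PI_RGT_0).
refine (is_RInt_le _ _ _ _ _ _ _ HJ HI _); [lra |].
intros t Ht.
assert (0 <= sin t) by (apply sin_ge_0; lra).
assert (Hs1 := SIN_bound t).
replace n with (m + (n - m))%nat by lia; rewrite pow_add.
rewrite <- (Rmult_1_r (sin t ^ m)) at 2.
apply Rmult_le_compat_l; [now apply pow_le |].
rewrite <- (pow1 (n - m)); apply pow_incr; lra.
Qed.

(** Wallis: consecutive integrals of powers of the sine decrease, and the three
    around [2 n] differ by factors tending to [1]. *)
Lemma cbin_sqr_limit : is_lim_seq (fun n => INR n * cbin n ^ 2) (/ PI).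
Proof.
assert (HPI := PI_RGT_0).
apply (is_lim_seq_le_le (fun n => / PI - / PI * / (2 * INR n + 1)) _ (fun _ => / PI)).
- intros n; assert (Hn := pos_INR n); assert (Hc := cbin_bounds n); split.
  + assert (H := wallis_le _ _ _ _ (Nat.le_add_r (2 * n) 1) (wallis_even n) (wallis_odd n)).
    apply (Rmult_le_compat_r (2 * INR n * cbin n / PI)) in H;
      [| apply Rdiv_le_0_compat; [nra | lra]].
    replace (/ PI - / PI * / (2 * INR n + 1))
      with (/ ((2 * INR n + 1) * cbin n) * (2 * INR n * cbin n / PI)) by (field; lra).
    apply Rle_trans with (1 := H); right; field; lra.
  + destruct n as [| n]; [simpl; generalize (Rinv_0_lt_compat _ HPI); lra |].
    assert (H := wallis_le (2 * n + 1) (2 * S n) _ _ ltac:(lia)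
                   (wallis_odd n) (wallis_even (S n))).
    assert (Hn' := pos_INR n); assert (Hc' := cbin_bounds n).
    apply (Rmult_le_compat_r (2 * INR (S n) * cbin (S n) / PI)) in H;
      [| apply Rdiv_le_0_compat; [nra | lra]].
    apply Rle_trans with (PI / 2 * cbin (S n) * (2 * INR (S n) * cbin (S n) / PI));
      [right; field; lra |].
    apply Rle_trans with (1 := H); right; rewrite cbin_S, S_INR; field; lra.
- replace (Finite (/ PI)) with (Finite (/ PI - / PI * 0)) by (f_equal; ring).
  apply is_lim_seq_minus'; [apply is_lim_seq_const |].
  apply (is_lim_seq_scal_l _ (/ PI) (Finite 0)).
  apply (is_lim_seq_le_le (fun _ => 0) _ (fun n => / INR (S n))).
  + intros n; rewrite S_INR; assert (Hn := pos_INR n); split.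
    * apply Rlt_le, Rinv_0_lt_compat; lra.
    * apply Rinv_le_contravar; lra.
  + apply is_lim_seq_const.
  + apply (is_lim_seq_incr_1 (fun n => / INR n)).
    replace (Finite 0) with (Rbar_inv p_infty) by easy.
    apply is_lim_seq_inv; [apply is_lim_seq_INR | easy].
- apply is_lim_seq_const.
Qed.

Lemma cbin_sqr_limit_0 : is_lim_seq (fun n => cbin n ^ 2) 0.
Proof.
apply (is_lim_seq_le_le (fun _ => 0) _ (fun n => / INR (S n))).
- intros n; split; [apply pow2_ge_0 |]; rewrite S_INR; apply cbin_sqr_le.
- apply is_lim_seq_const.
- apply (is_lim_seq_incr_1 (fun n => / INR n)).
  replace (Finite 0) with (Rbar_inv p_infty) by easy.
  apply is_lim_seq_inv; [apply is_lim_seq_INR | easy].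
Qed.

(** * Primitives of the binomial series *)

Lemma abs_summable_cbin j : (1 <= j)%nat -> abs_summable (integrated 2 j cbin).
Proof.
intros Hj; apply abs_summable_le with (2 := ex_series_cbin); intros n.
generalize (cbin_bounds n) (pos_INR n) (le_INR _ _ Hj); simpl INR; intros H1 H2 H3.
unfold integrated; simpl INR; rewrite Rabs_pos_eq.
- apply Rmult_le_compat_l; [lra |]; apply Rinv_le_contravar; lra.
- apply Rdiv_le_0_compat; lra.
Qed.

Lemma abs_summable_integrated m j c :
  (1 <= j)%nat -> abs_summable c -> abs_summable (integrated m j c).
Proof.
intros Hj Hc; apply abs_summable_le with (2 := Hc); intros n.
generalize (pos_INR n) (pos_INR m) (le_INR _ _ Hj); simpl INR; intros H2 H3 H4.
assert (1 <= INR m * INR n + INR j) by nra.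
unfold integrated, Rdiv; rewrite Rabs_mult, (Rabs_pos_eq (/ _)).
- rewrite <- (Rmult_1_r (Rabs (c n))) at 2.
  apply Rmult_le_compat_l; [apply Rabs_pos |].
  rewrite <- Rinv_1; apply Rinv_le_contravar; lra.
- apply Rlt_le, Rinv_0_lt_compat; lra.
Qed.

(** For [t = sin x] the binomial series [1 / sqrt (1 - t ^ 2)] cancels the [cos x]
    of [dt], and only the primitive of a power of the sine is left. *)
Lemma series_primitive_cbin_sin j (G : R -> R) b :
  (1 <= j)%nat -> 0 <= b <= PI / 2 -> G 0 = 0 ->
  (forall x, is_derive G x (sin x ^ (j - 1))) ->
  series_primitive 2 j cbin 1 (sin b) = G b.
Proof.
intros Hj Hb HG0 HG.
apply (series_primitive_closed_form 2 j cbin 1 sin cos G b);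
  try easy; try lia; try lra; [apply unit_radius_cbin | apply sin_0 | | | |].
- intros x _; auto_derive; [easy | ring].
- intros x _; apply (ex_derive_continuous G); eexists; apply HG.
- intros x _; now apply continuous_series_primitive, abs_summable_cbin.
- intros x Hx; assert (0 < sin x) by (apply sin_gt_0; lra).
  assert (0 < cos x) by (apply cos_gt_0; lra).
  assert (E := sin2_cos2 x); unfold Rsqr in E.
  assert (Hx1 : -1 < 1 * sin x ^ 2 < 1) by (simpl; nra).
  split; [lra | split; [easy |]].
  rewrite PSeries_cbin by now apply Rabs_lt_1.
  replace (1 - 1 * sin x ^ 2) with (cos x * cos x) by (simpl; lra).
  rewrite sqrt_square by lra.
  replace (_ * cos x) with (sin x ^ (j - 1)) by (field; lra); apply HG.
Qed.

Lemma cosh_sqr x : cosh x * cosh x = 1 + sinh x * sinh x.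
Proof.
assert (E : exp x * exp (- x) = 1) by (rewrite <- exp_plus, Rplus_opp_r; apply exp_0).
unfold cosh, sinh; field_simplify; nra.
Qed.

Lemma series_primitive_cbin_sinh j (G : R -> R) b :
  (1 <= j)%nat -> 0 <= b -> sinh b < 1 -> G 0 = 0 ->
  (forall x, is_derive G x (sinh x ^ (j - 1))) ->
  series_primitive 2 j cbin (-1) (sinh b) = G b.
Proof.
intros Hj Hb Hb1 HG0 HG.
apply (series_primitive_closed_form 2 j cbin (-1) sinh cosh G b);
  try easy; try lia; try lra; [apply unit_radius_cbin | apply sinh_0 | | | |].
- intros x _; apply is_derive_Reals, derivable_pt_lim_sinh.
- intros x _; apply (ex_derive_continuous G); eexists; apply HG.
- intros x _; now apply continuous_series_primitive, abs_summable_cbin.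
- intros x Hx.
  assert (0 < sinh x) by (rewrite <- sinh_0; apply sinh_lt; lra).
  assert (sinh x < sinh b) by (apply sinh_lt; lra).
  assert (0 < cosh x) by (unfold cosh; generalize (exp_pos x) (exp_pos (- x)); lra).
  assert (E := cosh_sqr x).
  assert (Hx1 : -1 < -1 * sinh x ^ 2 < 1) by (simpl; nra).
  split; [lra | split; [easy |]].
  rewrite PSeries_cbin by now apply Rabs_lt_1.
  replace (1 - -1 * sinh x ^ 2) with (cosh x * cosh x) by (simpl; lra).
  rewrite sqrt_square by lra.
  replace (_ * cosh x) with (sinh x ^ (j - 1)) by (field; lra); apply HG.
Qed.

Lemma series_primitive_cbin_sin_1 b : 0 <= b <= PI / 2 -> series_primitive 2 1 cbin 1 (sin b) = b.
Proof.
intros Hb; apply (series_primitive_cbin_sin 1 (fun x => x)); try easy; try lia.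
intros x; simpl; apply (is_derive_id (K := R_AbsRing)).
Qed.

Lemma series_primitive_cbin_sin_3 b : 0 <= b <= PI / 2 ->
  series_primitive 2 3 cbin 1 (sin b) = (b - sin b * cos b) / 2.
Proof.
intros Hb; apply (series_primitive_cbin_sin 3 (fun x => (x - sin x * cos x) / 2));
  try easy; try lia; [rewrite sin_0; field |].
intros x; auto_derive; [easy |]; simpl.
assert (E := sin2_cos2 x); unfold Rsqr in E; nra.
Qed.

Lemma series_primitive_cbin_sin_5 b : 0 <= b <= PI / 2 ->
  series_primitive 2 5 cbin 1 (sin b)
  = 3 / 8 * b - 3 / 8 * (sin b * cos b) - sin b ^ 3 * cos b / 4.
Proof.
intros Hb; apply (series_primitive_cbin_sin 5
   (fun x => 3 / 8 * x - 3 / 8 * (sin x * cos x) - sin x ^ 3 * cos x / 4));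
  try easy; try lia; [rewrite sin_0; field |].
intros x; auto_derive; [easy |].
assert (E : cos x ^ 2 = 1 - sin x ^ 2)
  by (generalize (sin2_cos2 x); unfold Rsqr; intros; lra).
transitivity (3 / 8 - 3 / 8 * (cos x ^ 2 - sin x ^ 2)
              - (3 * sin x ^ 2 * cos x ^ 2 - sin x ^ 4) / 4); [simpl; field |].
rewrite E; simpl; field.
Qed.

Lemma series_primitive_cbin_sinh_1 b : 0 <= b -> sinh b < 1 ->
  series_primitive 2 1 cbin (-1) (sinh b) = b.
Proof.
intros Hb Hb1; apply (series_primitive_cbin_sinh 1 (fun x => x)); try easy; try lia.
intros x; simpl; apply (is_derive_id (K := R_AbsRing)).
Qed.

Lemma is_derive_sinh x : is_derive sinh x (cosh x).
Proof. apply is_derive_Reals, derivable_pt_lim_sinh. Qed.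

Lemma series_primitive_cbin_sinh_3 b : 0 <= b -> sinh b < 1 ->
  series_primitive 2 3 cbin (-1) (sinh b) = (sinh b * cosh b - b) / 2.
Proof.
intros Hb Hb1; apply (series_primitive_cbin_sinh 3 (fun x => (sinh x * cosh x - x) / 2));
  try easy; try lia; [rewrite sinh_0; field |].
intros x; unfold sinh, cosh; auto_derive; [easy |]; simpl.
assert (E : exp (- x) = / exp x) by apply exp_Ropp.
rewrite E; field; apply Rgt_not_eq, exp_pos.
Qed.

Lemma series_primitive_cbin_sinh_5 b : 0 <= b -> sinh b < 1 ->
  series_primitive 2 5 cbin (-1) (sinh b)
  = 3 / 8 * b - 3 / 8 * (sinh b * cosh b) + sinh b ^ 3 * cosh b / 4.
Proof.
intros Hb Hb1; apply (series_primitive_cbin_sinh 5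
   (fun x => 3 / 8 * x - 3 / 8 * (sinh x * cosh x) + sinh x ^ 3 * cosh x / 4));
  try easy; try lia; [rewrite sinh_0; field |].
intros x; unfold sinh, cosh; auto_derive; [easy |]; simpl.
assert (E : exp (- x) = / exp x) by apply exp_Ropp.
rewrite E; field; apply Rgt_not_eq, exp_pos.
Qed.

(** * Dilogarithms *)

(** [Ti2], the primitive of [atan t / t], whose value at [1] is Catalan's
    constant. *)
Definition Ti2 (t : R) : R := series_primitive 2 1 (integrated 2 1 (fun _ => 1)) (-1) t.

(** The primitives of [asin t / t] (for [eps = 1]) and [arsinh t / t] (for
    [eps = -1]). *)
Definition arcsine_dilog (eps t : R) : R := series_primitive 2 1 (integrated 2 1 cbin) eps t.

Definition Li2 (x : R) : R := series_primitive 1 1 (integrated 1 1 (fun _ => 1)) 1 x.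

Lemma arcsine_dilog_sin_continuous x : continuous (fun t => arcsine_dilog 1 (sin t)) x.
Proof.
apply (continuous_comp sin (arcsine_dilog 1)).
- apply (ex_derive_continuous sin); auto_derive; easy.
- apply continuous_series_primitive.
  now apply abs_summable_integrated, abs_summable_cbin.
Qed.

Lemma is_derive_arcsine_dilog_sin x :
  0 < x < PI / 2 ->
  is_derive (fun t => arcsine_dilog 1 (sin t)) x (x * cos x / sin x).
Proof.
intros Hx; assert (Hs : 0 < sin x) by (apply sin_gt_0; lra).
assert (0 < cos x) by (apply cos_gt_0; lra).
assert (E := sin2_cos2 x); unfold Rsqr in E.
assert (Hx1 : -1 < 1 * sin x ^ 2 < 1) by (simpl; nra).
replace (x * cos x / sin x) with (scal (cos x) (x / sin x))
  by (unfold scal; simpl; unfold mult; simpl; field; lra).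
apply (is_derive_comp (arcsine_dilog 1) sin); [| auto_derive; [easy | ring]].
assert (HD := is_derive_integrated 2 1 (integrated 2 1 cbin) 1 (sin x)
  (unit_radius_integrated 2 1 _ unit_radius_cbin ltac:(lia) ltac:(lia))
  ltac:(lia) ltac:(lia) ltac:(lra) ltac:(lra) Hx1).
replace (x / sin x) with (sin x ^ (1 - 1) * PSeries (integrated 2 1 cbin) (1 * sin x ^ 2));
  [exact HD |].
assert (P := series_primitive_cbin_sin_1 x ltac:(lra)); unfold series_primitive in P.
rewrite cps_eq in P by easy; rewrite <- P at 3; simpl; field; lra.
Qed.

Lemma is_derive_arcsine_dilog_sinh x :
  0 < x -> sinh x < 1 ->
  is_derive (fun t => arcsine_dilog (-1) (sinh t)) x (x * cosh x / sinh x).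
Proof.
intros Hx Hx1; assert (Hs : 0 < sinh x) by (rewrite <- sinh_0; apply sinh_lt; lra).
assert (Hx2 : -1 < -1 * sinh x ^ 2 < 1) by (simpl; nra).
replace (x * cosh x / sinh x) with (scal (cosh x) (x / sinh x))
  by (unfold scal; simpl; unfold mult; simpl; field; lra).
apply (is_derive_comp (arcsine_dilog (-1)) sinh); [| apply is_derive_sinh].
assert (HD := is_derive_integrated 2 1 (integrated 2 1 cbin) (-1) (sinh x)
  (unit_radius_integrated 2 1 _ unit_radius_cbin ltac:(lia) ltac:(lia))
  ltac:(lia) ltac:(lia) ltac:(lra) ltac:(lra) Hx2).
replace (x / sinh x)
  with (sinh x ^ (1 - 1) * PSeries (integrated 2 1 cbin) (-1 * sinh x ^ 2)); [exact HD |].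
assert (P := series_primitive_cbin_sinh_1 x ltac:(lra) Hx1); unfold series_primitive in P.
rewrite cps_eq in P by easy; rewrite <- P at 3; simpl; field; lra.
Qed.

Lemma arcsine_dilog_0 eps : arcsine_dilog eps 0 = 0.
Proof. now apply series_primitive_0. Qed.

(** The duplication formula [cot x = 2 cot (2 x) + tan x] and the reflection
    [x -> PI / 2 - x] leave only [tan] in the derivative of the combination
    below. *)
Lemma arcsine_dilog_1 : arcsine_dilog 1 1 = PI / 2 * ln 2.
Proof.
assert (HPI := PI_RGT_0).
set (f t := arcsine_dilog 1 (sin t)).
assert (Hf : forall g x, ex_derive g x -> continuous (fun t => f (g t)) x).
{ intros g x Hg; apply (continuous_comp g f); [now apply ex_derive_continuous |].
  apply arcsine_dilog_sin_continuous. }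
assert (E : f 0 - / 2 * f (2 * 0) - f (PI / 2 - 0) + PI / 2 * ln (cos 0)
  = f (PI / 4) - / 2 * f (2 * (PI / 4)) - f (PI / 2 - PI / 4) + PI / 2 * ln (cos (PI / 4))).
{ apply (eq_of_derive_zero
    (fun x => f x - / 2 * f (2 * x) - f (PI / 2 - x) + PI / 2 * ln (cos x))); [lra | |].
  - intros x Hx.
    assert (0 < sin x) by (apply sin_gt_0; lra).
    assert (0 < cos x) by (apply cos_gt_0; lra).
    assert (0 < sin (2 * x)) by (apply sin_gt_0; lra).
    assert (D1 := is_derive_arcsine_dilog_sin x ltac:(lra)).
    assert (D2 := is_derive_arcsine_dilog_sin (2 * x) ltac:(lra)).
    assert (D3 := is_derive_arcsine_dilog_sin (PI / 2 - x) ltac:(lra)).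
    fold f in D1, D2, D3.
    evar_last.
    { apply (is_derive_plus (fun x => f x - / 2 * f (2 * x) - f (PI / 2 - x))
               (fun x => PI / 2 * ln (cos x))).
      - apply (is_derive_minus (fun x => f x - / 2 * f (2 * x)) (fun x => f (PI / 2 - x))).
        + apply (is_derive_minus f (fun x => / 2 * f (2 * x))); [exact D1 |].
          apply (is_derive_scal (fun x => f (2 * x))).
          apply (is_derive_comp f (fun x => 2 * x)); [exact D2 |].
          auto_derive; [easy | reflexivity].
        + apply (is_derive_comp f (fun x => PI / 2 - x)); [exact D3 |].
          auto_derive; [easy | reflexivity].
      - auto_derive; [easy | reflexivity]. }
    unfold plus, minus, opp, scal, mult; simpl; unfold plus, opp, mult; simpl.
    rewrite cos_shift, sin_shift, sin_2a, cos_2a.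
    replace (cos x * cos x) with (1 - sin x * sin x)
      by (generalize (sin2_cos2 x); unfold Rsqr; lra).
    field_simplify; [| lra].
    replace (cos x ^ 2) with (1 - sin x ^ 2)
      by (generalize (sin2_cos2 x); unfold Rsqr; lra).
    field; lra.
  - intros x Hx; assert (0 < cos x) by (apply cos_gt_0; lra).
    apply (continuous_plus (fun x => f x - / 2 * f (2 * x) - f (PI / 2 - x))
             (fun x => PI / 2 * ln (cos x))).
    + apply (continuous_minus (fun x => f x - / 2 * f (2 * x)) (fun x => f (PI / 2 - x))).
      * apply (continuous_minus f (fun x => / 2 * f (2 * x)));
          [apply (Hf (fun t => t)); auto_derive; easy |].
        apply (continuous_mult (fun _ => / 2) (fun x => f (2 * x)));
          [apply continuous_const | apply Hf; auto_derive; easy].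
      * apply Hf; auto_derive; easy.
    + apply (ex_derive_continuous (fun x => PI / 2 * ln (cos x))); auto_derive; lra. }
replace (2 * (PI / 4)) with (PI / 2) in E by field.
replace (PI / 2 - PI / 4) with (PI / 4) in E by field.
rewrite Rmult_0_r, Rminus_0_r, cos_0, ln_1, cos_PI4 in E.
unfold f in E; rewrite sin_0, arcsine_dilog_0, sin_PI2 in E.
assert (0 < sqrt 2) by (apply sqrt_lt_R0; lra).
assert (L : ln (1 / sqrt 2) = - (ln 2 / 2)).
{ unfold Rdiv at 1; rewrite Rmult_1_l, ln_Rinv by easy.
  rewrite <- (sqrt_sqrt 2) at 2 by lra; rewrite ln_mult by easy; field. }
rewrite L in E; lra.
Qed.

(** Restricted to [t < 1]: the coefficients [1 / (2 n + 1)] are not summable. *)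
Lemma series_primitive_geom_atan t : 0 <= t < 1 -> series_primitive 2 1 (fun _ => 1) (-1) t = atan t.
Proof.
intros Ht; apply (series_primitive_closed_form 2 1 (fun _ => 1) (-1) (fun x => x) (fun _ => 1) atan);
  try easy; try lia; try lra; [apply unit_radius_geom | apply atan_0 | | | |].
- intros x _; apply (is_derive_id (K := R_AbsRing)).
- intros x _; apply (ex_derive_continuous atan); auto_derive; easy.
- intros x Hx; apply continuous_series_primitive_inside; try lia; [apply unit_radius_geom |].
  simpl; nra.
- intros x Hx; assert (Hx1 : -1 < -1 * x ^ 2 < 1) by (simpl; nra).
  split; [lra | split; [easy |]].
  rewrite PSeries_geom by now apply Rabs_lt_1.
  auto_derive; [easy |]; unfold Rsqr; simpl; field; nra.
Qed.

Lemma abs_summable_odd_squares :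
  abs_summable (integrated 2 1 (integrated 2 1 (fun _ => 1))).
Proof.
assert (H : abs_summable (backward_diff (fun n => / (INR n + 1)))).
{ apply (abs_summable_backward_diff _ (-1) 0); [now right | |].
  - intros n; rewrite S_INR; assert (Hn := pos_INR n).
    assert (/ (INR n + 1 + 1) <= / (INR n + 1)) by (apply Rinv_le_contravar; lra).
    lra.
  - apply (is_lim_seq_ext (fun n => / INR (S n))); [intros n; now rewrite S_INR |].
    apply (is_lim_seq_incr_1 (fun n => / INR n)).
    replace (Finite 0) with (Rbar_inv p_infty) by easy.
    apply is_lim_seq_inv; [apply is_lim_seq_INR | easy]. }
apply abs_summable_le with (2 := H); intros [| n]; unfold integrated.
- simpl; rewrite !Rabs_pos_eq; [| rewrite Rplus_0_l, Rinv_1; lra | ]; field_simplify; lra.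
- assert (Hn := pos_INR n); unfold backward_diff; rewrite Rabs_minus_sym, (S_INR n).
  simpl INR; rewrite !Rabs_pos_eq.
  + apply Rminus_le_0.
    replace (_ - _) with ((3 * INR n ^ 2 + 9 * INR n + 7)
       / ((INR n + 1) * (INR n + 2) * (2 * INR n + 3) ^ 2)) by (field; lra).
    apply Rdiv_le_0_compat; [nra |].
    apply Rmult_lt_0_compat; [nra | apply pow_lt; lra].
  + replace (_ - _) with (/ ((INR n + 1) * (INR n + 2))) by (field; lra).
    apply Rlt_le, Rinv_0_lt_compat; nra.
  + unfold Rdiv; rewrite Rmult_1_l, <- Rinv_mult.
    apply Rlt_le, Rinv_0_lt_compat; nra.
Qed.

Lemma is_derive_Ti2 t : 0 < t < 1 -> is_derive Ti2 t (atan t / t).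
Proof.
intros Ht; assert (Ht1 : -1 < -1 * t ^ 2 < 1) by (simpl; nra).
assert (HD := is_derive_integrated 2 1 (integrated 2 1 (fun _ => 1)) (-1) t
  (unit_radius_integrated 2 1 _ unit_radius_geom ltac:(lia) ltac:(lia))
  ltac:(lia) ltac:(lia) ltac:(lra) ltac:(lra) Ht1).
replace (atan t / t)
  with (t ^ (1 - 1) * PSeries (integrated 2 1 (fun _ => 1)) (-1 * t ^ 2)); [exact HD |].
assert (P := series_primitive_geom_atan t ltac:(lra)); unfold series_primitive in P.
rewrite cps_eq in P by easy; rewrite <- P; simpl; field; lra.
Qed.

Lemma Ti2_1 : Ti2 1 = catalan.
Proof.
unfold Ti2, series_primitive, cps, catalan; rewrite clamp_id by lra.
unfold PSeries; simpl; rewrite !Rmult_1_l; apply Series_ext; intros n.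
unfold integrated; simpl INR; rewrite !Rmult_1_r.
generalize (pos_INR n); intros; field; lra.
Qed.

(** [2 cot x - 2 cot (2 x) = cot x + tan x = 1 / (sin x cos x)], and
    [x / (sin x cos x)] is the derivative of [Ti2 (tan x)]. *)
Lemma arcsine_dilog_sin_PI4 :
  arcsine_dilog 1 (sin (PI / 4)) = PI / 8 * ln 2 + catalan / 2.
Proof.
assert (HPI := PI_RGT_0).
set (f t := arcsine_dilog 1 (sin t)).
assert (Hf : forall g x, ex_derive g x -> continuous (fun t => f (g t)) x).
{ intros g x Hg; apply (continuous_comp g f); [now apply ex_derive_continuous |].
  apply arcsine_dilog_sin_continuous. }
assert (E : 2 * f 0 - / 2 * f (2 * 0) - Ti2 (tan 0)
  = 2 * f (PI / 4) - / 2 * f (2 * (PI / 4)) - Ti2 (tan (PI / 4))).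
{ apply (eq_of_derive_zero (fun x => 2 * f x - / 2 * f (2 * x) - Ti2 (tan x)));
    [lra | |].
  - intros x Hx.
    assert (0 < sin x) by (apply sin_gt_0; lra).
    assert (0 < cos x) by (apply cos_gt_0; lra).
    assert (0 < sin (2 * x)) by (apply sin_gt_0; lra).
    assert (Ht1 : tan x < 1) by (rewrite <- tan_PI4; apply tan_increasing; lra).
    assert (Ht0 : 0 < tan x) by (apply tan_gt_0; lra).
    assert (D1 := is_derive_arcsine_dilog_sin x ltac:(lra)).
    assert (D2 := is_derive_arcsine_dilog_sin (2 * x) ltac:(lra)).
    assert (D3 := is_derive_Ti2 (tan x) ltac:(lra)).
    fold f in D1, D2.
    evar_last.
    { apply (is_derive_minus (fun x => 2 * f x - / 2 * f (2 * x)) (fun x => Ti2 (tan x))).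
      - apply (is_derive_minus (fun x => 2 * f x) (fun x => / 2 * f (2 * x))).
        + apply (is_derive_scal f); exact D1.
        + apply (is_derive_scal (fun x => f (2 * x))).
          apply (is_derive_comp f (fun x => 2 * x)); [exact D2 |].
          auto_derive; [easy | reflexivity].
      - apply (is_derive_comp Ti2 tan); [exact D3 |].
        unfold tan; auto_derive; [lra | reflexivity]. }
    unfold plus, minus, opp, scal, mult; simpl; unfold plus, opp, mult; simpl.
    rewrite atan_tan by lra.
    rewrite sin_2a, cos_2a; unfold tan.
    field; lra.
  - intros x Hx; assert (0 < cos x) by (apply cos_gt_0; lra).
    apply (continuous_minus (fun x => 2 * f x - / 2 * f (2 * x)) (fun x => Ti2 (tan x))).
    + apply (continuous_minus (fun x => 2 * f x) (fun x => / 2 * f (2 * x))).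
      * apply (continuous_mult (fun _ => 2) f);
          [apply continuous_const | apply (Hf (fun t => t)); auto_derive; easy].
      * apply (continuous_mult (fun _ => / 2) (fun x => f (2 * x)));
          [apply continuous_const | apply Hf; auto_derive; easy].
    + apply (continuous_comp tan Ti2).
      * apply (ex_derive_continuous tan); unfold tan; auto_derive; lra.
      * apply continuous_series_primitive, abs_summable_odd_squares. }
replace (2 * (PI / 4)) with (PI / 2) in E by field.
rewrite Rmult_0_r, tan_0, tan_PI4, Ti2_1 in E.
assert (T0 : Ti2 0 = 0) by now apply series_primitive_0.
unfold f in E; rewrite sin_0, arcsine_dilog_0, sin_PI2, arcsine_dilog_1, T0 in E.
lra.
Qed.

(** * The dilogarithm at the inverse golden ratio *)

(** Integrating [x = sum_n cbin n * sin x ^ (2 n + 1) / (2 n + 1)] over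
    [[0, PI / 2]]: the Wallis integral of [sin ^ (2 n + 1)] cancels [cbin n]. *)
Lemma Series_odd_squares :
  Series (integrated 2 1 (integrated 2 1 (fun _ => 1))) = PI ^ 2 / 8.
Proof.
assert (HPI := PI_RGT_0).
assert (H : is_RInt (fun x => x) 0 (PI / 2)
  (Series (fun n => integrated 2 1 cbin n * / ((2 * INR n + 1) * cbin n)))).
{ apply (is_RInt_series (fun n x => integrated 2 1 cbin n * sin x ^ (2 * n + 1))
          _ _ (fun n => Rabs (integrated 2 1 cbin n))); [lra | | | |].
  - intros n; apply (is_RInt_scal (V := R_NormedModule)), wallis_odd.
  - now apply abs_summable_cbin.
  - intros n x _; apply Rabs_mult_pow_le.
    assert (H1 := SIN_bound x); lra.
  - intros x Hx.
    cut (is_series (fun n => integrated 2 1 cbin n * sin x ^ (2 * n + 1))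
           (series_primitive 2 1 cbin 1 (sin x)));
      [now rewrite series_primitive_cbin_sin_1 by lra |].
    assert (0 < sin x) by (apply sin_gt_0; lra).
    assert (0 < cos x) by (apply cos_gt_0; lra).
    assert (E := sin2_cos2 x); unfold Rsqr in E.
    unfold series_primitive.
    apply (is_series_ext (fun n => scal (sin x ^ 1)
             (integrated 2 1 cbin n * (1 * sin x ^ 2) ^ n))).
    + intros n; unfold scal; simpl; unfold mult; simpl.
      replace (n + (n + 0) + 1)%nat with (S (2 * n)) by lia.
      change (sin x ^ S (2 * n)) with (sin x * sin x ^ (2 * n)).
      rewrite pow_mult, !Rmult_1_r, Rmult_1_l.
      replace (sin x ^ 2) with (sin x * sin x) by ring; ring.
    + apply (is_series_scal (V := R_NormedModule)), cps_is_series;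
        [now apply abs_summable_cbin | simpl; nra]. }
assert (H' : is_RInt (fun x => x) 0 (PI / 2) ((PI / 2) ^ 2 / 2 - 0 ^ 2 / 2)).
{ apply (is_RInt_derive (fun x => x ^ 2 / 2)).
  - intros x _; auto_derive; [easy | simpl; field].
  - intros x _; apply continuous_id. }
apply (is_RInt_unique (V := R_CompleteNormedModule)) in H.
apply (is_RInt_unique (V := R_CompleteNormedModule)) in H'.
replace (PI ^ 2 / 8) with ((PI / 2) ^ 2 / 2 - 0 ^ 2 / 2) by field.
rewrite <- H', H; apply Series_ext; intros n; unfold integrated; simpl INR.
generalize (pos_INR n) (cbin_bounds n); intros; field; lra.
Qed.

Lemma abs_summable_squares : abs_summable (integrated 1 1 (integrated 1 1 (fun _ => 1))).
Proof.
unfold abs_summable; apply ex_series_incr_1.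
apply abs_summable_le with (d := fun n => 4 * Rabs (integrated 2 1 (integrated 2 1 (fun _ => 1)) n)).
- intros n; unfold integrated; rewrite (S_INR n); simpl INR; assert (Hn := pos_INR n).
  rewrite !Rabs_pos_eq.
  + apply Rminus_le_0.
    replace (_ - _) with ((12 * INR n + 15) / ((INR n + 2) ^ 2 * (2 * INR n + 1) ^ 2))
      by (field; lra).
    apply Rdiv_le_0_compat; [lra |].
    apply Rmult_lt_0_compat; apply pow_lt; lra.
  + unfold Rdiv; rewrite Rmult_1_l, <- Rinv_mult; apply Rlt_le, Rinv_0_lt_compat; nra.
  + unfold Rdiv; rewrite Rmult_1_l, <- Rinv_mult; apply Rlt_le, Rinv_0_lt_compat; nra.
- apply (ex_series_scal (V := R_NormedModule) 4), abs_summable_odd_squares.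
Qed.

Lemma Li2_continuous x : continuous Li2 x.
Proof. apply continuous_series_primitive, abs_summable_squares. Qed.

Lemma Li2_0 : Li2 0 = 0.
Proof. now apply series_primitive_0. Qed.

Lemma is_derive_series_primitive_id c x :
  unit_radius c -> -1 < x < 1 -> x <> 0 ->
  is_derive (series_primitive 1 1 c 1) x (PSeries c x).
Proof.
intros Hc Hx Hx0.
replace (PSeries c x) with (x ^ (1 - 1) * PSeries c (1 * x ^ 1))
  by (change (1 - 1)%nat with 0%nat; now rewrite pow_O, pow_1, !Rmult_1_l).
apply is_derive_integrated; try easy; try lia; try lra.
Qed.

Lemma series_primitive_geom_ln x :
  -1 < x < 1 -> series_primitive 1 1 (fun _ => 1) 1 x = - ln (1 - x).
Proof.
intros Hx.
cut (series_primitive 1 1 (fun _ => 1) 1 x + ln (1 - x) = 0); [lra |].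
rewrite (eq_of_derive_zero_punctured
  (fun y => series_primitive 1 1 (fun _ => 1) 1 y + ln (1 - y)) (-1) 1 0);
  [| lra | | | easy].
- rewrite series_primitive_0, Rminus_0_r, ln_1 by easy; ring.
- apply (continuous_plus (series_primitive 1 1 (fun _ => 1) 1) (fun y => ln (1 - y))).
  + apply continuous_series_primitive_inside; try easy; [apply unit_radius_geom |].
    simpl; lra.
  + apply (ex_derive_continuous (fun y => ln (1 - y))); auto_derive; lra.
- intros y Hy Hy0.
  replace 0 with (PSeries (fun _ => 1) y + - / (1 - y))
    by (rewrite PSeries_geom by (now apply Rabs_lt_1); ring).
  apply (is_derive_plus (series_primitive 1 1 (fun _ => 1) 1) (fun y => ln (1 - y))).
  + apply is_derive_series_primitive_id; [apply unit_radius_geom | easy | easy].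
  + auto_derive; [lra | unfold Rminus; ring].
Qed.

Lemma is_derive_Li2 x :
  -1 < x < 1 -> x <> 0 -> is_derive Li2 x (- ln (1 - x) / x).
Proof.
intros Hx Hx0.
replace (- ln (1 - x) / x) with (PSeries (integrated 1 1 (fun _ => 1)) x).
- apply is_derive_series_primitive_id; [| easy | easy].
  apply unit_radius_integrated; try easy; apply unit_radius_geom.
- rewrite <- series_primitive_geom_ln by easy; unfold series_primitive.
  rewrite pow_1, Rmult_1_l, cps_eq by easy; field; easy.
Qed.

Lemma Li2_PSeries x :
  -1 <= x <= 1 -> Li2 x = x * PSeries (integrated 1 1 (integrated 1 1 (fun _ => 1))) x.
Proof.
intros Hx; unfold Li2, series_primitive, cps.
now rewrite pow_1, Rmult_1_l, clamp_id.
Qed.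

(** Splitting the coefficients [1 / (n + 1) ^ 2] by the parity of [n]. *)
Lemma PSeries_squares_parity x :
  -1 <= x <= 1 ->
  PSeries (integrated 1 1 (integrated 1 1 (fun _ => 1))) x
  = PSeries (integrated 2 1 (integrated 2 1 (fun _ => 1))) (x ^ 2)
    + x * / 4 * PSeries (integrated 1 1 (integrated 1 1 (fun _ => 1))) (x ^ 2).
Proof.
intros Hx; assert (Hx2 : -1 <= x ^ 2 <= 1) by (simpl; nra).
set (c := integrated 1 1 _); set (d := integrated 2 1 _).
assert (Hd : forall n, c (2 * n)%nat = d n).
{ intros n; unfold c, d, integrated; rewrite mult_INR; simpl INR.
  generalize (pos_INR n); intros; field; lra. }
assert (Hc : forall n, c (2 * n + 1)%nat = / 4 * c n).
{ intros n; unfold c, integrated; rewrite plus_INR, mult_INR; simpl INR.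
  generalize (pos_INR n); intros; field; lra. }
assert (Hex : forall e, abs_summable e -> ex_pseries e (x ^ 2)).
{ intros e He; apply ex_pseries_R; eexists; now apply cps_is_series. }
rewrite PSeries_odd_even.
- rewrite (PSeries_ext _ d) by apply Hd; f_equal.
  rewrite (PSeries_ext _ (PS_scal (/ 4) c)) by apply Hc.
  rewrite PSeries_scal; ring.
- apply (ex_pseries_ext d); [intros; symmetry; apply Hd |].
  apply Hex, abs_summable_odd_squares.
- apply (ex_pseries_ext (PS_scal (/ 4) c)); [intros; symmetry; apply Hc |].
  apply (ex_pseries_scal (V := R_NormedModule)); [apply Rmult_comm |].
  apply Hex, abs_summable_squares.
Qed.

(** The odd-numbered terms of [sum 1 / n ^ 2] were summed above; the even-numbered
    ones are a quarter of the whole. *)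
Lemma Li2_1 : Li2 1 = PI ^ 2 / 6.
Proof.
rewrite Li2_PSeries by lra.
assert (E := PSeries_squares_parity 1 ltac:(lra)); rewrite pow1 in E.
assert (D : PSeries (integrated 2 1 (integrated 2 1 (fun _ => 1))) 1 = PI ^ 2 / 8).
{ rewrite <- Series_odd_squares; apply Series_ext; intros n.
  now rewrite pow1, Rmult_1_r. }
lra.
Qed.

Lemma Li2_square x : -1 <= x <= 1 -> Li2 x + Li2 (- x) = Li2 (x ^ 2) / 2.
Proof.
intros Hx; assert (Hx2 : -1 <= x ^ 2 <= 1) by (simpl; nra).
rewrite !Li2_PSeries by lra.
rewrite (PSeries_squares_parity x), (PSeries_squares_parity (- x)) by lra.
replace ((- x) ^ 2) with (x ^ 2) by ring; field.
Qed.

(** From [ln w < w] at [w = / sqrt x]. *)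
Lemma Rabs_mult_ln_le x : 0 < x < 1 -> Rabs (x * ln x) <= 2 * sqrt x.
Proof.
intros Hx; assert (Hs : 0 < sqrt x) by (apply sqrt_lt_R0; lra).
assert (Hss : sqrt x * sqrt x = x) by (apply sqrt_sqrt; lra).
assert (Hln : ln x <= 0).
{ rewrite <- ln_1; apply Rlt_le, ln_increasing; lra. }
rewrite Rabs_left1 by nra.
assert (E : ln x = - 2 * ln (/ sqrt x)).
{ rewrite ln_Rinv by easy; rewrite <- Hss at 1; rewrite ln_mult by easy; ring. }
assert (H : ln (/ sqrt x) < / sqrt x).
{ apply Rlt_le_trans with (ln (exp (/ sqrt x))); [| rewrite ln_exp; lra].
  apply ln_increasing; [now apply Rinv_0_lt_compat |].
  generalize (exp_ineq1 (/ sqrt x)) (Rinv_0_lt_compat _ Hs); lra. }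
rewrite E.
replace (- (x * (-2 * ln (/ sqrt x)))) with (2 * (sqrt x * (sqrt x * ln (/ sqrt x))))
  by (transitivity (2 * (sqrt x * sqrt x) * ln (/ sqrt x)); [ring | rewrite Hss; ring]).
assert (sqrt x * ln (/ sqrt x) <= 1); [| nra].
rewrite <- (Rinv_r (sqrt x)) by lra; apply Rmult_le_compat_l; lra.
Qed.

Lemma continuous_mult_ln_0 : continuous (fun x => x * ln x) 0.
Proof.
apply filterlim_locally; intros eps.
rewrite Rmult_0_l.
assert (He : 0 < Rmin 1 ((eps / 2) ^ 2)).
{ apply Rmin_glb_lt; [lra |]; apply pow_lt; generalize (cond_pos eps); lra. }
exists (mkposreal _ He); intros x Hx.
change (Rabs (x - 0) < Rmin 1 ((eps / 2) ^ 2)) in Hx; rewrite Rminus_0_r in Hx.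
change (Rabs (x * ln x - 0) < eps); rewrite Rminus_0_r.
destruct (Rle_lt_dec x 0) as [Hx0 | Hx0].
- (* the logarithm is extended by zero to the nonpositive reals *)
  replace (ln x) with 0; [rewrite Rmult_0_r, Rabs_R0; apply cond_pos |].
  unfold ln; destruct (Rlt_dec 0 x) as [H | H]; [exfalso; lra | easy].
- rewrite Rabs_pos_eq in Hx by lra.
  assert (H1 := Rmin_l 1 ((eps / 2) ^ 2)); assert (H2 := Rmin_r 1 ((eps / 2) ^ 2)).
  eapply Rle_lt_trans; [apply Rabs_mult_ln_le; lra |].
  assert (sqrt x < eps / 2); [| lra].
  rewrite <- (sqrt_pow2 (eps / 2)) by (generalize (cond_pos eps); lra).
  apply sqrt_lt_1; try lra; apply pow2_ge_0.
Qed.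

(** Euler's reflection.  The product of logarithms extends continuously to [0]
    because [ln (1 - x) = O(x)]. *)
Lemma Li2_reflection x :
  0 < x < 1 -> Li2 x + Li2 (1 - x) + ln x * ln (1 - x) = PI ^ 2 / 6.
Proof.
intros Hx.
set (p y := cps (integrated 1 1 (fun _ => 1)) y).
assert (Hp : forall y, -1 < y < 1 -> ln (1 - y) = - (y * p y)).
{ intros y Hy; generalize (series_primitive_geom_ln y Hy); unfold series_primitive, p.
  rewrite pow_1, Rmult_1_l; lra. }
assert (Hpc : forall y, -1 < y < 1 -> continuous p y).
{ intros y Hy; apply (continuous_ext_loc _ (PSeries (integrated 1 1 (fun _ => 1)))).
  - apply (filter_imp (fun y => -1 < y < 1)); [| now apply locally_between].
    intros z Hz; unfold p; now rewrite cps_eq.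
  - apply unit_radius_continuous; [| now apply Rabs_lt_1].
    apply unit_radius_integrated; try easy; apply unit_radius_geom. }
set (F y := Li2 y + Li2 (1 - y) - y * ln y * p y).
assert (E : F 0 = F x).
{ apply eq_of_derive_zero; [lra | |].
  - intros y Hy; unfold F.
    apply (is_derive_ext_loc (fun y => Li2 y + Li2 (1 - y) + ln y * ln (1 - y))).
    + apply (filter_imp (fun y => -1 < y < 1)); [| apply locally_between; lra].
      intros z Hz; rewrite (Hp z Hz); unfold F.
      change (Li2 z + Li2 (1 - z) + ln z * - (z * p z)
              = Li2 z + Li2 (1 - z) - z * ln z * p z); ring.
    + evar_last.
      { apply (is_derive_plus (fun y => Li2 y + Li2 (1 - y)) (fun y => ln y * ln (1 - y))).
        - apply (is_derive_plus Li2 (fun y => Li2 (1 - y))).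
          + apply is_derive_Li2; lra.
          + apply (is_derive_comp Li2 (fun y => 1 - y)); [apply is_derive_Li2; lra |].
            auto_derive; [easy | reflexivity].
        - auto_derive; [lra | reflexivity]. }
      unfold plus, scal; simpl; unfold mult; simpl.
      replace (1 - (1 - y)) with y by ring.
      replace (1 + - y) with (1 - y) by ring; field; lra.
  - intros y Hy; unfold F.
    apply (continuous_minus (fun y => Li2 y + Li2 (1 - y)) (fun y => y * ln y * p y)).
    + apply (continuous_plus Li2 (fun y => Li2 (1 - y))); [apply Li2_continuous |].
      apply (continuous_comp (fun y => 1 - y) Li2); [| apply Li2_continuous].
      apply (ex_derive_continuous (fun y => 1 - y)); auto_derive; easy.
    + apply (continuous_mult (fun y => y * ln y) p); [| apply Hpc; lra].
      destruct (Req_dec y 0) as [-> | Hy0]; [apply continuous_mult_ln_0 |].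
      apply (ex_derive_continuous (fun y => y * ln y)); auto_derive; lra. }
unfold F in E; rewrite Li2_0, Rminus_0_r, Li2_1 in E.
rewrite (Hp x) by lra; lra.
Qed.

Lemma Li2_Landen x :
  0 <= x < 1 / 2 -> Li2 x + Li2 (x / (x - 1)) + ln (1 - x) ^ 2 / 2 = 0.
Proof.
intros Hx.
assert (Hb : forall y, 0 <= y < 1 / 2 -> -1 < y / (y - 1) <= 0).
{ intros y Hy; assert (E : y / (y - 1) * (1 - y) = - y) by (field; lra).
  split; nra. }
assert (E : Li2 0 + Li2 (0 / (0 - 1)) + ln (1 - 0) ^ 2 / 2
            = Li2 x + Li2 (x / (x - 1)) + ln (1 - x) ^ 2 / 2).
{ apply (eq_of_derive_zero
    (fun x => Li2 x + Li2 (x / (x - 1)) + ln (1 - x) ^ 2 / 2)); [lra | |].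
  - intros y Hy; specialize (Hb y ltac:(lra)).
    assert (y / (y - 1) <> 0).
    { intros Hz; apply (Rmult_eq_compat_r (y - 1)) in Hz.
      unfold Rdiv in Hz; rewrite Rmult_assoc, Rinv_l in Hz; lra. }
    evar_last.
    { apply (is_derive_plus (fun x => Li2 x + Li2 (x / (x - 1)))
              (fun x => ln (1 - x) ^ 2 / 2)).
      - apply (is_derive_plus Li2 (fun x => Li2 (x / (x - 1)))).
        + apply is_derive_Li2; lra.
        + apply (is_derive_comp Li2 (fun x => x / (x - 1))).
          * apply is_derive_Li2; [lra | easy].
          * auto_derive; [lra | reflexivity].
      - auto_derive; [lra | reflexivity]. }
    unfold plus, scal; simpl; unfold mult; simpl.
    replace (1 - y / (y - 1)) with (/ (1 - y)) by (field; lra).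
    rewrite ln_Rinv by lra.
    replace (1 + - y) with (1 - y) by ring; field; lra.
  - intros y Hy; specialize (Hb y ltac:(lra)).
    apply (continuous_plus (fun x => Li2 x + Li2 (x / (x - 1)))
             (fun x => ln (1 - x) ^ 2 / 2)).
    + apply (continuous_plus Li2 (fun x => Li2 (x / (x - 1)))); [apply Li2_continuous |].
      apply (continuous_comp (fun x => x / (x - 1)) Li2); [| apply Li2_continuous].
      apply (ex_derive_continuous (fun x => x / (x - 1))); auto_derive; lra.
    + apply (ex_derive_continuous (fun x => ln (1 - x) ^ 2 / 2)); auto_derive; lra. }
rewrite <- E; replace (0 / (0 - 1)) with 0 by field.
rewrite Li2_0, Rminus_0_r, ln_1; field.
Qed.

Lemma golden_ratio_bounds : 3 / 2 < golden_ratio < 2.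
Proof.
unfold golden_ratio; assert (H := sqrt_sqrt 5 ltac:(lra)).
assert (0 < sqrt 5) by (apply sqrt_lt_R0; lra); split; nra.
Qed.

Lemma golden_ratio_sqr : golden_ratio * golden_ratio = golden_ratio + 1.
Proof.
unfold golden_ratio; assert (H := sqrt_sqrt 5 ltac:(lra)); nra.
Qed.

(** With [a = / golden_ratio] one has [1 - a = a ^ 2] and
    [a ^ 2 / (a ^ 2 - 1) = - a], so that reflection at [a], Landen at [a ^ 2] and
    the square formula at [a] close up on [Li2 a], [Li2 (- a)], [Li2 (a ^ 2)]. *)
Lemma Li2_inv_golden_ratio :
  Li2 (/ golden_ratio) = PI ^ 2 / 10 - ln golden_ratio ^ 2.
Proof.
assert (Hb := golden_ratio_bounds); assert (E := golden_ratio_sqr).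
set (a := / golden_ratio).
assert (Ha : a = golden_ratio - 1).
{ unfold a; apply Rmult_eq_reg_l with golden_ratio; [| lra].
  rewrite Rinv_r by lra; lra. }
assert (Ha2 : a ^ 2 = 1 - a) by (rewrite Ha; simpl; lra).
assert (Ha01 : 1 / 2 < a < 1) by (rewrite Ha; lra).
assert (La : ln a = - ln golden_ratio) by (unfold a; apply ln_Rinv; lra).
assert (R := Li2_reflection a ltac:(lra)).
assert (S := Li2_square a ltac:(lra)).
assert (La2 : ln (1 - a) = 2 * ln a).
{ rewrite <- Ha2; simpl; rewrite Rmult_1_r, ln_mult by lra; ring. }
assert (L := Li2_Landen (1 - a) ltac:(lra)).
replace ((1 - a) / (1 - a - 1)) with (- a) in L
  by (rewrite <- Ha2 at 1; field; lra).
replace (1 - (1 - a)) with a in L by ring.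
rewrite Ha2 in S; rewrite La2 in R; rewrite La in R, L.
lra.
Qed.

Lemma sinh_ln_golden_ratio : sinh (ln golden_ratio) = 1 / 2.
Proof.
assert (Hb := golden_ratio_bounds); assert (E := golden_ratio_sqr).
unfold sinh; rewrite exp_Ropp, exp_ln by lra.
apply Rmult_eq_reg_l with golden_ratio; [| lra].
field_simplify; nra.
Qed.

(** The function [x ^ 2 / 2 + Li2 (1 - exp (- 2 x)) / 2] has the derivative
    [x coth x] of [arcsine_dilog (-1) (sinh x)].  At [x = ln golden_ratio] the argument
    [1 - exp (- 2 x)] is [/ golden_ratio]. *)
Lemma arcsine_dilog_half : arcsine_dilog (-1) (1 / 2) = PI ^ 2 / 20.
Proof.
assert (Hb := golden_ratio_bounds); assert (E := golden_ratio_sqr).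
set (L := ln golden_ratio).
assert (HL : 0 < L) by (unfold L; rewrite <- ln_1; apply ln_increasing; lra).
assert (Hexp : exp (- L) = golden_ratio - 1).
{ unfold L; rewrite exp_Ropp, exp_ln by lra.
  apply Rmult_eq_reg_l with golden_ratio; [| lra]; rewrite Rinv_r by lra; lra. }
assert (HsL : sinh L = 1 / 2) by apply sinh_ln_golden_ratio.
set (q x := exp (- 2 * x)).
assert (K : arcsine_dilog (-1) (sinh 0) - 0 ^ 2 / 2 - Li2 (1 - q 0) / 2
  = arcsine_dilog (-1) (sinh L) - L ^ 2 / 2 - Li2 (1 - q L) / 2).
{ apply (eq_of_derive_zero
   (fun x => arcsine_dilog (-1) (sinh x) - x ^ 2 / 2 - Li2 (1 - q x) / 2)); [lra | |].
  - intros x Hx.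
    assert (Hs1 : sinh x < sinh L) by (apply sinh_lt; lra).
    assert (Hs0 : 0 < sinh x) by (rewrite <- sinh_0; apply sinh_lt; lra).
    assert (Hq : 0 < q x < 1).
    { unfold q; split; [apply exp_pos |]; rewrite <- exp_0; apply exp_increasing; lra. }
    evar_last.
    { apply (is_derive_minus (fun x => arcsine_dilog (-1) (sinh x) - x ^ 2 / 2)
               (fun x => Li2 (1 - q x) / 2)).
      - apply (is_derive_minus (fun x => arcsine_dilog (-1) (sinh x)) (fun x => x ^ 2 / 2)).
        + apply is_derive_arcsine_dilog_sinh; lra.
        + auto_derive; [easy | reflexivity].
      - apply (is_derive_ext (fun x => / 2 * Li2 (1 - q x)));
          [intros; apply Rmult_comm |].
        apply (is_derive_scal (fun x => Li2 (1 - q x))).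
        apply (is_derive_comp Li2 (fun x => 1 - q x)).
        + apply is_derive_Li2; lra.
        + unfold q; auto_derive; [easy | reflexivity]. }
    unfold minus, plus, opp, scal; simpl; unfold mult; simpl.
    replace (1 - (1 - q x)) with (q x) by ring.
    replace (ln (q x)) with (- 2 * x) by (unfold q; now rewrite ln_exp).
    fold (q x).
    assert (Ex : exp x * exp (- x) = 1)
      by (rewrite <- exp_plus, Rplus_opp_r; apply exp_0).
    assert (Eq : q x = exp (- x) * exp (- x))
      by (unfold q; rewrite <- exp_plus; f_equal; ring).
    assert (Hsq : 1 - q x = 2 * sinh x * exp (- x)) by (rewrite Eq; unfold sinh; nra).
    assert (Hcq : 1 + q x = 2 * cosh x * exp (- x)) by (rewrite Eq; unfold cosh; nra).
    assert (He := exp_pos (- x)).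
    replace (cosh x) with ((1 + q x) / (2 * exp (- x))) by (rewrite Hcq; field; lra).
    replace (sinh x) with ((1 - q x) / (2 * exp (- x))) by (rewrite Hsq; field; lra).
    field; lra.
  - intros x Hx.
    apply (continuous_minus (fun x => arcsine_dilog (-1) (sinh x) - x ^ 2 / 2)
               (fun x => Li2 (1 - q x) / 2)).
    + apply (continuous_minus (fun x => arcsine_dilog (-1) (sinh x)) (fun x => x ^ 2 / 2)).
      * apply (continuous_comp sinh (arcsine_dilog (-1))).
        -- apply (ex_derive_continuous sinh); eexists; apply is_derive_sinh.
        -- apply continuous_series_primitive.
           now apply abs_summable_integrated, abs_summable_cbin.
      * apply (ex_derive_continuous (fun x => x ^ 2 / 2)); auto_derive; easy.
    + apply (continuous_mult (fun x => Li2 (1 - q x)) (fun _ => / 2));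
        [| apply continuous_const].
      apply (continuous_comp (fun x => 1 - q x) Li2); [| apply Li2_continuous].
      apply (ex_derive_continuous (fun x => 1 - q x)); unfold q; auto_derive; easy. }
rewrite HsL, sinh_0, arcsine_dilog_0 in K.
assert (Eq : 1 - q L = / golden_ratio).
{ unfold q; replace (-2 * L) with (- L + - L) by ring; rewrite exp_plus, Hexp.
  apply Rmult_eq_reg_l with golden_ratio; [| lra]; rewrite Rinv_r by lra; nra. }
rewrite Eq, Li2_inv_golden_ratio in K; fold L in K.
unfold q in K; rewrite Rmult_0_r, exp_0, Rminus_diag, Li2_0 in K.
lra.
Qed.

(** * Elliptic integrals as power series in the parameter *)

Definition cbin2 (n : nat) : R := cbin n ^ 2.

Definition cbin3 (n : nat) : R := cbin n ^ 3.

Lemma cbin2_bounds n : 0 <= cbin2 n <= 1.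
Proof. unfold cbin2; generalize (cbin_bounds n); intros; simpl; nra. Qed.

Lemma euler_cbin2_bounds n : 0 <= euler cbin2 n <= 1.
Proof.
unfold euler; assert (Hn := pos_INR n); generalize (cbin2_bounds n); intros H.
split; [nra |].
assert (H1 := cbin_sqr_le n); fold (cbin2 n) in H1.
apply (Rmult_le_compat_l (INR n + 1)) in H1; [| lra].
rewrite Rinv_r in H1; lra.
Qed.

Lemma unit_radius_cbin2 : unit_radius cbin2.
Proof.
apply unit_radius_of_bound with 1; intros n; generalize (cbin2_bounds n).
intros; rewrite Rabs_pos_eq; lra.
Qed.

Lemma unit_radius_cbin3 : unit_radius cbin3.
Proof.
apply unit_radius_of_bound with 1; intros n; unfold cbin3.
generalize (cbin_bounds n); intros H; rewrite Rabs_pos_eq.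
- rewrite <- (pow1 3); apply pow_incr; lra.
- apply pow_le; lra.
Qed.

(** [U0] is [2 / PI * K] as a function of the parameter, [U1] and [U2] are its
    images under one and two applications of [z d/dz]. *)
Definition U0 : R -> R := PSeries cbin2.
Definition U1 : R -> R := PSeries (euler cbin2).
Definition U2 : R -> R := PSeries (euler (euler cbin2)).

Lemma Rabs_mult_sin2 z x : Rabs z < 1 -> Rabs (z * sin x ^ 2) < 1.
Proof.
intros Hz; rewrite Rabs_mult; apply Rle_lt_trans with (2 := Hz).
rewrite <- (Rmult_1_r (Rabs z)) at 2.
apply Rmult_le_compat_l; [apply Rabs_pos |].
generalize (SIN_bound x); intros; rewrite Rabs_pos_eq by apply pow2_ge_0; simpl; nra.
Qed.

(** Termwise integration with the even Wallis integrals; [K] and [E] are the cases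
    [(1 - x) ^ (- 1 / 2)] and [(1 - x) ^ (1 / 2)]. *)
Lemma is_RInt_PSeries_sin2 (c : nat -> R) (z : R) :
  unit_radius c -> Rabs z < 1 ->
  is_RInt (fun x => PSeries c (z * sin x ^ 2)) 0 (PI / 2)
    (PI / 2 * PSeries (fun n => c n * cbin n) z).
Proof.
intros Hc Hz; assert (HPI := PI_RGT_0).
unfold PSeries at 2; rewrite <- Series_scal_l.
rewrite (Series_ext _ (fun n => c n * z ^ n * (PI / 2 * cbin n))) by (intros; ring).
apply (is_RInt_series (fun n x => c n * z ^ n * sin x ^ (2 * n)) _ _
         (fun n => Rabs (c n * z ^ n))); [lra | | | |].
- intros n; apply (is_RInt_scal (V := R_NormedModule)), wallis_even.
- apply CV_disk_inside; now apply unit_radius_inside.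
- intros n x _; apply Rabs_mult_pow_le.
  generalize (SIN_bound x); lra.
- intros x _; apply (is_series_ext (fun n => c n * (z * sin x ^ 2) ^ n)).
  + intros n; rewrite Rpow_mult_distr, <- pow_mult; symmetry; apply Rmult_assoc.
  + apply unit_radius_is_series; [easy | now apply Rabs_mult_sin2].
Qed.

Lemma is_RInt_K z :
  Rabs z < 1 ->
  is_RInt (fun x => / sqrt (1 - z * sin x ^ 2)) 0 (PI / 2) (PI / 2 * U0 z).
Proof.
intros Hz; eapply is_RInt_ext.
- intros x _; apply PSeries_cbin; now apply Rabs_mult_sin2.
- unfold U0; rewrite (PSeries_ext cbin2 (fun n => cbin n * cbin n))
    by (intros; unfold cbin2; ring).
  apply is_RInt_PSeries_sin2; [apply unit_radius_cbin | easy].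
Qed.

(** This is [E = (1 - z) K + 2 z (1 - z) dK/dz].  The root is obtained as
    [(1 - x) * (1 - x) ^ (- 1 / 2)], that is by differencing [cbin]. *)
Lemma is_RInt_E z :
  Rabs z < 1 ->
  is_RInt (fun x => sqrt (1 - z * sin x ^ 2)) 0 (PI / 2)
    (PI / 2 * ((1 - z) * (U0 z + 2 * U1 z))).
Proof.
intros Hz; assert (Hu := unit_radius_cbin).
assert (Hbd : unit_radius (backward_diff cbin)).
{ apply unit_radius_backward_diff; intros n; generalize (cbin_bounds n); lra. }
eapply is_RInt_ext.
- intros x _; transitivity (PSeries (backward_diff cbin) (z * sin x ^ 2)); [reflexivity |].
  assert (Hx := Rabs_mult_sin2 z x Hz).
  rewrite <- PSeries_backward_diff, PSeries_cbin by easy.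
  apply Rabs_lt_between in Hx.
  assert (Hs : 0 < sqrt (1 - z * sin x ^ 2)) by (apply sqrt_lt_R0; lra).
  rewrite <- (sqrt_sqrt (1 - z * sin x ^ 2)) at 1 by lra.
  rewrite Rmult_assoc, Rinv_r by lra; apply Rmult_1_r.
- replace ((1 - z) * (U0 z + 2 * U1 z))
    with (PSeries (fun n => backward_diff cbin n * cbin n) z);
    [now apply is_RInt_PSeries_sin2 |].
  unfold U0, U1; assert (H2 := unit_radius_cbin2).
  rewrite (PSeries_ext _ (fun n => 1 * backward_diff cbin2 n
                                   + 2 * backward_diff (euler cbin2) n)).
  + rewrite PSeries_comb2;
      auto using unit_radius_backward_diff, cbin2_bounds, euler_cbin2_bounds.
    rewrite <- !PSeries_backward_diff; auto using unit_radius_euler; ring.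
  + intros [| n]; unfold backward_diff, euler, cbin2; [simpl; ring |].
    rewrite S_INR, cbin_S; generalize (pos_INR n); intros; field; lra.
Qed.

(** The differential equation of [K]: for [theta = z d/dz], it reads
    [theta^2 u = z (theta + 1/2)^2 u]. *)
Lemma U2_eq z : Rabs z < 1 -> (1 - z) * U2 z = z * (U1 z + U0 z / 4).
Proof.
intros Hz; assert (H2 := unit_radius_cbin2).
cut (U2 z = 0 + z * (1 * U2 z + 1 * U1 z + / 4 * U0 z)); [lra |].
unfold U0, U1, U2; rewrite <- PSeries_comb3; auto using unit_radius_euler.
rewrite PSeries_shift at 1; auto using unit_radius_euler.
f_equal; [unfold euler; simpl; ring |]; f_equal; apply PSeries_ext; intros n.
unfold euler, cbin2; rewrite S_INR, cbin_S; generalize (pos_INR n); intros; field; lra.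
Qed.

Lemma is_derive_U0 z : Rabs z < 1 -> z <> 0 -> is_derive U0 z (U1 z / z).
Proof. intros; apply is_derive_PSeries_euler; auto using unit_radius_cbin2. Qed.

(** [(1 - z) U1] is [z (1 - z) u'] for [u = U0], so this is the self-adjoint form
    [(z (1 - z) u')' = u / 4] of the differential equation. *)
Lemma is_derive_flux z :
  Rabs z < 1 -> z <> 0 -> is_derive (fun y => (1 - y) * U1 y) z (U0 z / 4).
Proof.
intros Hz Hz0.
replace (U0 z / 4) with (-1 * U1 z + (1 - z) * (U2 z / z)).
- apply (is_derive_mult (fun y => 1 - y) U1); [| | exact Rmult_comm].
  + auto_derive; [easy | ring].
  + apply is_derive_PSeries_euler; auto using unit_radius_cbin2, unit_radius_euler.
- transitivity (- U1 z + (1 - z) * U2 z / z); [field; easy |].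
  rewrite U2_eq by easy; field; easy.
Qed.

Lemma U0_pos z : -1 < z < 1 -> 0 < U0 z.
Proof.
intros Hz; assert (HPI := PI_RGT_0).
assert (H := is_RInt_K z (Rabs_lt_1 z Hz)).
apply (is_RInt_unique (V := R_CompleteNormedModule)) in H.
assert (Hpos : forall x, 0 < 1 - z * sin x ^ 2).
{ intros x; generalize (Rabs_mult_sin2 z x (Rabs_lt_1 z Hz)); intros Hx.
  apply Rabs_lt_between in Hx; lra. }
assert (0 < RInt (fun x => / sqrt (1 - z * sin x ^ 2)) 0 (PI / 2)); [| nra].
apply RInt_gt_0; [lra | |].
- intros x _; now apply Rinv_0_lt_compat, sqrt_lt_R0.
- intros x _; apply (ex_derive_continuous (fun x => / sqrt (1 - z * sin x ^ 2))).
  assert (Hs := sqrt_lt_R0 _ (Hpos x)); specialize (Hpos x).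
  auto_derive; split; [exact Hpos | split; [| easy]]; apply Rgt_not_eq, Hs.
Qed.

(** * Clausen's formula *)

(** Clausen's hypergeometric series [3F2 (1/2, 1/2, 1/2; 1, 1)] and its images
    under [t d/dt]; [S3_eq] is its differential equation
    [theta^3 S = t (theta + 1/2)^3 S]. *)
Definition S0 : R -> R := PSeries cbin3.
Definition S1 : R -> R := PSeries (euler cbin3).
Definition S2 : R -> R := PSeries (euler (euler cbin3)).
Definition S3 : R -> R := PSeries (euler (euler (euler cbin3))).

Lemma S3_eq t :
  Rabs t < 1 -> (1 - t) * S3 t = t * (3 / 2 * S2 t + 3 / 4 * S1 t + / 8 * S0 t).
Proof.
intros Ht; assert (H3 := unit_radius_cbin3).
cut (S3 t = 0 + t * (1 * S3 t + 1 * (3 / 2 * S2 t + 3 / 4 * S1 t + / 8 * S0 t)));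
  [lra |].
assert (Hc : unit_radius (fun n => 3 / 2 * euler (euler cbin3) n
                            + 3 / 4 * euler cbin3 n + / 8 * cbin3 n)).
{ auto 10 using unit_radius_plus, unit_radius_scal, unit_radius_euler. }
unfold S0, S1, S2, S3.
rewrite <- (PSeries_comb3 _ _ _ (3 / 2)); auto using unit_radius_euler.
rewrite <- PSeries_comb2; auto using unit_radius_euler.
rewrite PSeries_shift at 1; auto using unit_radius_euler.
f_equal; [unfold euler; simpl; ring |]; f_equal; apply PSeries_ext; intros n.
unfold euler, cbin3; rewrite S_INR, cbin_S; generalize (pos_INR n); intros; field; lra.
Qed.

Definition clausen_arg (z : R) : R := 4 * (z * (1 - z)).

(** The condition [4 z (1 - z) > - 1] holds for [z > (1 - sqrt 2) / 2], which is
    slightly less than [- 1 / 5]; all parameters used are larger. *)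
Lemma clausen_arg_bound z : -1 / 5 < z < 1 / 2 -> Rabs (clausen_arg z) < 1.
Proof. intros Hz; apply Rabs_def1; unfold clausen_arg; nra. Qed.

Lemma is_derive_clausen_arg c z :
  unit_radius c -> -1 / 5 < z < 1 / 2 -> z <> 0 ->
  is_derive (fun y => PSeries c (clausen_arg y)) z
    ((1 - 2 * z) * PSeries (euler c) (clausen_arg z) / (z * (1 - z))).
Proof.
intros Hc Hz Hz0.
assert (Ht0 : clausen_arg z <> 0) by (unfold clausen_arg; nra).
replace (_ / _) with (scal (4 * (1 - 2 * z)) (PSeries (euler c) (clausen_arg z) / clausen_arg z)).
- apply (is_derive_comp (PSeries c) clausen_arg).
  + apply is_derive_PSeries_euler; [easy | | easy]; now apply clausen_arg_bound.
  + unfold clausen_arg; auto_derive; [easy | ring].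
- unfold scal; simpl; unfold mult; simpl; unfold clausen_arg; field; lra.
Qed.

(** Put [d = z (1 - z) d/dz], so that [d d u = z (1 - z) u / 4] for the solution
    [u] of the equation of [K], and [l = d u].  Let [v = s0] be Clausen's series in
    [4 z (1 - z)]; then [d v = (1 - 2 z) s1].  The equation of [v] is the one satisfied
    by squares of solutions [u], and it can be integrated: with [D = u ^ 2 d] it says
    [D (D (D (v / u ^ 2))) = 0].  Here [D (v / u ^ 2) = (1 - 2 z) s1 - 2 s0 l / u], and
    the function below is [D (D (v / u ^ 2))], in which the divisions by [u] cancel. *)
Definition second_wronskian (u l s0 s1 s2 : R -> R) (z : R) : R :=
  u z ^ 2 * ((1 - 2 * z) ^ 2 * s2 z - 2 * (z * (1 - z)) * s1 z)
  - 2 * (u z * l z) * ((1 - 2 * z) * s1 z)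
  + 2 * (s0 z * l z ^ 2) - z * (1 - z) / 2 * (u z ^ 2 * s0 z).

Lemma is_derive_second_wronskian (u l s0 s1 s2 : R -> R) (s3 z : R) :
  0 < 1 - z -> z <> 0 ->
  is_derive u z (l z / (z * (1 - z))) ->
  is_derive l z (u z / 4) ->
  is_derive s0 z ((1 - 2 * z) * s1 z / (z * (1 - z))) ->
  is_derive s1 z ((1 - 2 * z) * s2 z / (z * (1 - z))) ->
  is_derive s2 z ((1 - 2 * z) * s3 / (z * (1 - z))) ->
  (1 - 4 * (z * (1 - z))) * s3
    = 4 * (z * (1 - z)) * (3 / 2 * s2 z + 3 / 4 * s1 z + / 8 * s0 z) ->
  is_derive (second_wronskian u l s0 s1 s2) z 0.
Proof.
intros H1z Hz0 Du Dl D0 D1 D2 E; unfold second_wronskian.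
auto_derive; [repeat split; eexists; eassumption |].
assert (Eu : Derive (fun x : R => u x) z = _) by exact (is_derive_unique _ _ _ Du).
assert (El : Derive (fun x : R => l x) z = _) by exact (is_derive_unique _ _ _ Dl).
assert (E0 : Derive (fun x : R => s0 x) z = _) by exact (is_derive_unique _ _ _ D0).
assert (E1 : Derive (fun x : R => s1 x) z = _) by exact (is_derive_unique _ _ _ D1).
assert (E2 : Derive (fun x : R => s2 x) z = _) by exact (is_derive_unique _ _ _ D2).
rewrite Eu, El, E0, E1, E2.
transitivity (u z ^ 2 * (1 - 2 * z) / (z * (1 - z))
  * ((1 - 4 * (z * (1 - z))) * s3
     - 4 * (z * (1 - z)) * (3 / 2 * s2 z + 3 / 4 * s1 z + / 8 * s0 z))).
- field; lra.
- rewrite E; ring.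
Qed.

Lemma is_derive_wronskian (u l s0 s1 s2 : R -> R) (z : R) :
  0 < 1 - z -> z <> 0 -> u z <> 0 ->
  is_derive u z (l z / (z * (1 - z))) ->
  is_derive l z (u z / 4) ->
  is_derive s0 z ((1 - 2 * z) * s1 z / (z * (1 - z))) ->
  is_derive s1 z ((1 - 2 * z) * s2 z / (z * (1 - z))) ->
  second_wronskian u l s0 s1 s2 z = 0 ->
  is_derive (fun x => (1 - 2 * x) * s1 x - 2 * (s0 x * l x) / u x) z 0.
Proof.
intros H1z Hz0 Hu Du Dl D0 D1 E.
auto_derive; [repeat split; try (eexists; eassumption); easy |].
assert (Eu : Derive (fun x : R => u x) z = _) by exact (is_derive_unique _ _ _ Du).
assert (El : Derive (fun x : R => l x) z = _) by exact (is_derive_unique _ _ _ Dl).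
assert (E0 : Derive (fun x : R => s0 x) z = _) by exact (is_derive_unique _ _ _ D0).
assert (E1 : Derive (fun x : R => s1 x) z = _) by exact (is_derive_unique _ _ _ D1).
rewrite Eu, El, E0, E1.
transitivity (second_wronskian u l s0 s1 s2 z / (z * (1 - z) * u z ^ 2)).
- unfold second_wronskian; field; repeat split; lra.
- rewrite E; unfold Rdiv; ring.
Qed.

Lemma continuous_second_wronskian (u l s0 s1 s2 : R -> R) (z : R) :
  continuous u z -> continuous l z -> continuous s0 z -> continuous s1 z ->
  continuous s2 z -> continuous (second_wronskian u l s0 s1 s2) z.
Proof. intros; unfold second_wronskian; simpl pow; continuous_R. Qed.

Lemma continuous_wronskian (u l s0 s1 : R -> R) (z : R) :
  u z <> 0 ->
  continuous u z -> continuous l z -> continuous s0 z -> continuous s1 z ->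
  continuous (fun x => (1 - 2 * x) * s1 x - 2 * (s0 x * l x) / u x) z.
Proof.
intros; unfold Rdiv; continuous_R; now apply continuous_Rinv_comp.
Qed.

Lemma U0_0 : U0 0 = 1.
Proof. unfold U0; rewrite PSeries_0; unfold cbin2; simpl; ring. Qed.

(** Both iterated derivatives of [v / u ^ 2] along [u ^ 2 z (1 - z) d/dz] are
    constant in turn, and vanish because that vector field vanishes at [0].  So
    [v / u ^ 2] itself is constant, equal to its value [1] at [0]. *)
Lemma clausen z : -1 / 5 < z < 1 / 2 -> U0 z ^ 2 = S0 (clausen_arg z).
Proof.
assert (H2 := unit_radius_cbin2); assert (H3 := unit_radius_cbin3).
set (l y := (1 - y) * U1 y).
set (s0 y := S0 (clausen_arg y)); set (s1 y := S1 (clausen_arg y)).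
set (s2 y := S2 (clausen_arg y)).
assert (Hin : forall y, -1 / 5 < y < 1 / 2 -> Rabs y < 1) by (intros; apply Rabs_def1; lra).
assert (Du : forall y, -1 / 5 < y < 1 / 2 -> y <> 0 ->
  is_derive U0 y (l y / (y * (1 - y)))).
{ intros y Hy Hy0; replace (l y / (y * (1 - y))) with (U1 y / y)
    by (unfold l; field; lra).
  apply is_derive_U0; auto. }
assert (Dl : forall y, -1 / 5 < y < 1 / 2 -> y <> 0 -> is_derive l y (U0 y / 4))
  by (intros; apply is_derive_flux; auto).
assert (D0 : forall y, -1 / 5 < y < 1 / 2 -> y <> 0 ->
  is_derive s0 y ((1 - 2 * y) * s1 y / (y * (1 - y))))
  by (intros; now apply is_derive_clausen_arg).
assert (D1 : forall y, -1 / 5 < y < 1 / 2 -> y <> 0 ->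
  is_derive s1 y ((1 - 2 * y) * s2 y / (y * (1 - y))))
  by (intros; apply is_derive_clausen_arg; auto using unit_radius_euler).
assert (Hu : forall y, -1 / 5 < y < 1 / 2 -> 0 < U0 y) by (intros; apply U0_pos; lra).
assert (Cu : continuous U0 0)
  by (apply unit_radius_continuous; auto; rewrite Rabs_R0; lra).
assert (Cl : continuous l 0).
{ apply (continuous_mult (fun y => 1 - y) U1).
  - apply (ex_derive_continuous (fun y => 1 - y)); auto_derive; easy.
  - apply unit_radius_continuous; auto using unit_radius_euler; rewrite Rabs_R0; lra. }
assert (Cs : forall c, unit_radius c -> continuous (fun y => PSeries c (clausen_arg y)) 0).
{ intros c Hc; apply (continuous_comp clausen_arg (PSeries c)).
  - unfold clausen_arg; apply (ex_derive_continuous (fun z => 4 * (z * (1 - z)))).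
    auto_derive; easy.
  - apply unit_radius_continuous; [easy |]; apply clausen_arg_bound; lra. }
assert (C0 : continuous s0 0) by now apply Cs.
assert (C1 : continuous s1 0) by (apply Cs; auto using unit_radius_euler).
assert (C2 : continuous s2 0) by (apply Cs; auto using unit_radius_euler).
assert (l0 : l 0 = 0)
  by (unfold l, U1; rewrite PSeries_0; unfold euler; simpl; ring).
assert (a0 : clausen_arg 0 = 0) by (unfold clausen_arg; ring).
assert (s00 : s0 0 = 1)
  by (unfold s0, S0; rewrite a0, PSeries_0; unfold cbin3; simpl; ring).
assert (s10 : s1 0 = 0)
  by (unfold s1, S1; rewrite a0, PSeries_0; unfold euler; simpl; ring).
assert (s20 : s2 0 = 0)
  by (unfold s2, S2; rewrite a0, PSeries_0; unfold euler; simpl; ring).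
assert (HA : forall y, -1 / 5 < y < 1 / 2 -> second_wronskian U0 l s0 s1 s2 y = 0).
{ intros y Hy.
  rewrite (eq_of_derive_zero_punctured (second_wronskian U0 l s0 s1 s2) (-1 / 5) (1 / 2) 0);
    [| lra | | | easy].
  - unfold second_wronskian; rewrite l0, s10, s20; field.
  - now apply continuous_second_wronskian.
  - intros x Hx Hx0; apply (is_derive_second_wronskian _ _ _ _ _ (S3 (clausen_arg x)));
      try lra; auto.
    + apply is_derive_clausen_arg; auto using unit_radius_euler.
    + apply S3_eq; now apply clausen_arg_bound. }
assert (HW : forall y, -1 / 5 < y < 1 / 2 ->
  (1 - 2 * y) * s1 y - 2 * (s0 y * l y) / U0 y = 0).
{ intros y Hy.
  rewrite (eq_of_derive_zero_punctured
    (fun x => (1 - 2 * x) * s1 x - 2 * (s0 x * l x) / U0 x) (-1 / 5) (1 / 2) 0);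
    [| lra | | | easy].
  - rewrite l0, s10; unfold Rdiv; ring.
  - apply continuous_wronskian; try easy; apply Rgt_not_eq, Hu; lra.
  - intros x Hx Hx0; apply (is_derive_wronskian _ _ _ _ s2); auto; try lra.
    specialize (Hu x Hx); lra. }
intros Hz.
assert (E : s0 z / U0 z ^ 2 = 1).
{ rewrite (eq_of_derive_zero_punctured (fun x => s0 x / U0 x ^ 2) (-1 / 5) (1 / 2) 0);
    [| lra | | | easy].
  - rewrite s00, U0_0; field.
  - unfold Rdiv; apply (continuous_mult s0 (fun x => / U0 x ^ 2)); [exact C0 |].
    apply continuous_Rinv_comp; [| rewrite U0_0; lra].
    apply (continuous_comp U0 (fun y => y ^ 2)); [exact Cu |].
    apply (ex_derive_continuous (fun y => y ^ 2)); auto_derive; easy.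
  - intros x Hx Hx0; specialize (HW x Hx); specialize (Hu x Hx).
    assert (Eu : Derive (fun x : R => U0 x) x = _)
      by exact (is_derive_unique _ _ _ (Du x Hx Hx0)).
    assert (E0 : Derive (fun x : R => s0 x) x = _)
      by exact (is_derive_unique _ _ _ (D0 x Hx Hx0)).
    auto_derive.
    + repeat split; [eexists; now apply D0 | eexists; now apply Du |].
      apply Rgt_not_eq; nra.
    + rewrite Eu, E0.
      transitivity (((1 - 2 * x) * s1 x - 2 * (s0 x * l x) / U0 x)
                    / (x * (1 - x) * U0 x ^ 2)); [field; lra |].
      rewrite HW; unfold Rdiv; ring. }
specialize (Hu z Hz); fold (s0 z).
apply (Rmult_eq_compat_r (U0 z ^ 2)) in E.
unfold Rdiv in E; rewrite Rmult_assoc, Rinv_l in E; [lra | simpl; nra].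
Qed.

(** * Moments of the elliptic integrals *)

(** [(1 - z) u] and [z (1 - z) u'] for [u = U0], extended to [z = 1], where [u]
    has a logarithmic singularity.  Their values there are the limits of [cbin n ^ 2]
    and of [n * cbin n ^ 2]. *)
Definition damped_U0 : R -> R := cps (backward_diff cbin2).
Definition damped_U1 : R -> R := cps (backward_diff (euler cbin2)).

Lemma abs_summable_damped_U0 : abs_summable (backward_diff cbin2).
Proof.
apply (abs_summable_backward_diff _ (-1) 0); [now right | | apply cbin_sqr_limit_0].
intros n; unfold cbin2; generalize (cbin_bounds n) (cbin_bounds (S n)) (cbin_decr n).
intros H1 H2 H3; generalize (pos_INR n); intros.
assert (0 < cbin n / (2 * INR n + 2)) by (apply Rdiv_lt_0_compat; lra).
replace (-1 * _) with ((cbin n - cbin (S n)) * (cbin n + cbin (S n))) by ring.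
apply Rmult_le_pos; lra.
Qed.

Lemma abs_summable_damped_U1 : abs_summable (backward_diff (euler cbin2)).
Proof.
apply (abs_summable_backward_diff _ 1 (/ PI)); [now left | | apply cbin_sqr_limit].
intros n; unfold euler, cbin2; rewrite S_INR, cbin_S.
assert (Hn := pos_INR n).
replace (1 * _) with (cbin n ^ 2 / (4 * (INR n + 1))) by (field; lra).
apply Rdiv_le_0_compat; [apply pow2_ge_0 | lra].
Qed.

Lemma damped_U0_eq z : -1 < z < 1 -> damped_U0 z = (1 - z) * U0 z.
Proof.
intros Hz; unfold damped_U0; rewrite cps_eq by easy.
rewrite <- PSeries_backward_diff; auto using unit_radius_cbin2, Rabs_lt_1.
Qed.

Lemma damped_U1_eq z : -1 < z < 1 -> damped_U1 z = (1 - z) * U1 z.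
Proof.
intros Hz; unfold damped_U1; rewrite cps_eq by easy.
rewrite <- PSeries_backward_diff;
  auto using unit_radius_cbin2, unit_radius_euler, Rabs_lt_1.
Qed.

Lemma damped_U0_at_1 : damped_U0 1 = 0.
Proof. apply cps_backward_diff_1, cbin_sqr_limit_0. Qed.

Lemma damped_U1_at_1 : damped_U1 1 = / PI.
Proof. apply cps_backward_diff_1, cbin_sqr_limit. Qed.

Lemma damped_U1_at_0 : damped_U1 0 = 0.
Proof.
rewrite damped_U1_eq by lra; unfold U1; rewrite PSeries_0; unfold euler; simpl; ring.
Qed.

Lemma continuous_damped_U0 z : continuous damped_U0 z.
Proof. apply continuous_cps, abs_summable_damped_U0. Qed.

Lemma continuous_damped_U1 z : continuous damped_U1 z.
Proof. apply continuous_cps, abs_summable_damped_U1. Qed.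

Lemma is_derive_damped_U1 z : 0 < z < 1 -> is_derive damped_U1 z (U0 z / 4).
Proof.
intros Hz; apply (is_derive_ext_loc (fun y => (1 - y) * U1 y)).
- apply (filter_imp (fun y => -1 < y < 1)); [| apply locally_between; lra].
  intros y Hy; now rewrite damped_U1_eq.
- apply is_derive_flux; [apply Rabs_lt_1 |]; lra.
Qed.

(** Multiplying [(z (1 - z) u')' = u / 4] by [(1 - z) ^ P] and integrating by parts
    twice shows that [(P + 1/2) ^ 2 (1 - z) ^ P u - P ^ 2 (1 - z) ^ (P - 1) u] is the
    derivative of [(1 - z) ^ P (z (1 - z) u' + P z u)], which vanishes at [0] and at
    [1] for [P >= 1].  For [P = 0] the flux [4 z (1 - z) u'] is itself the antiderivative,
    and its value [4 / PI] at [1] is where Wallis' product enters. *)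
Lemma moment_antiderivative p :
  exists H : R -> R,
    (forall z, continuous H z) /\
    (forall z, 0 < z < 1 -> is_derive H z ((1 - z) ^ p * U0 z)) /\
    H 0 = 0 /\ H 1 = 4 / PI / ((2 * INR p + 1) ^ 2 * cbin p ^ 2).
Proof.
assert (HPI := PI_RGT_0).
induction p as [| p (H & Hc & Hd & H0 & H1)].
- exists (fun z => 4 * damped_U1 z); split; [| split; [| split]].
  + intros z; apply (continuous_mult (fun _ => 4) damped_U1);
      [apply continuous_const | apply continuous_damped_U1].
  + intros z Hz; replace (_ * U0 z) with (4 * (U0 z / 4)) by (simpl; field).
    now apply (is_derive_scal damped_U1), is_derive_damped_U1.
  + rewrite damped_U1_at_0; ring.
  + rewrite damped_U1_at_1; simpl; field; lra.
- set (P := INR p + 1).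
  assert (HP : 1 <= P) by (unfold P; generalize (pos_INR p); lra).
  set (stuff z := (1 - z) ^ p * ((1 - z) * damped_U1 z + P * z * damped_U0 z)).
  exists (fun z => / (P + / 2) ^ 2 * (P ^ 2 * H z + stuff z)); split; [| split; [| split]].
  + intros z; assert (C0 := continuous_damped_U0); assert (C1 := continuous_damped_U1).
    unfold stuff; continuous_R.
  + intros z Hz.
    assert (Ds : is_derive stuff z
       ((P + / 2) ^ 2 * ((1 - z) ^ S p * U0 z) - P ^ 2 * ((1 - z) ^ p * U0 z))).
    { apply (is_derive_ext_loc
        (fun y => (1 - y) ^ S p * damped_U1 y + P * y * (1 - y) ^ S p * U0 y)).
      - apply (filter_imp (fun y => -1 < y < 1)); [| apply locally_between; lra].
        intros y Hy; unfold stuff; rewrite (damped_U0_eq y Hy).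
        change ((1 - y) ^ S p) with ((1 - y) * (1 - y) ^ p).
        change ((1 - y) * (1 - y) ^ p * damped_U1 y + P * y * ((1 - y) * (1 - y) ^ p) * U0 y
          = (1 - y) ^ p * ((1 - y) * damped_U1 y + P * y * ((1 - y) * U0 y))); ring.
      - evar_last.
        { apply (is_derive_plus (fun y => (1 - y) ^ S p * damped_U1 y)
                   (fun y => P * y * (1 - y) ^ S p * U0 y)).
          - apply (is_derive_mult (fun y => (1 - y) ^ S p) damped_U1);
              [| now apply is_derive_damped_U1 | exact Rmult_comm].
            auto_derive; [easy | reflexivity].
          - apply (is_derive_mult (fun y => P * y * (1 - y) ^ S p) U0);
              [| apply is_derive_U0; [apply Rabs_lt_1 |]; lra | exact Rmult_comm].
            auto_derive; [easy | reflexivity]. }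
        unfold plus, mult; simpl; rewrite damped_U1_eq by lra.
        change (match p with 0%nat => 1 | S _ => INR p + 1 end) with (INR (S p)).
        rewrite S_INR; fold P.
        unfold Rminus; field; lra. }
    replace ((1 - z) ^ S p * U0 z) with
      (/ (P + / 2) ^ 2 * (P ^ 2 * ((1 - z) ^ p * U0 z)
        + ((P + / 2) ^ 2 * ((1 - z) ^ S p * U0 z) - P ^ 2 * ((1 - z) ^ p * U0 z))))
      by (field; lra).
    apply (is_derive_scal (fun z => P ^ 2 * H z + stuff z)).
    apply (is_derive_plus (fun z => P ^ 2 * H z) stuff); [| exact Ds].
    now apply (is_derive_scal H), Hd.
  + unfold stuff; rewrite H0, damped_U1_at_0; ring.
  + unfold stuff; rewrite H1, damped_U0_at_1, S_INR, cbin_S; fold P.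
    generalize (pos_INR p) (cbin_bounds p); intros.
    replace (1 - 1) with 0 by ring.
    replace (_ + 0 ^ p * _) with (P ^ 2 * (4 / PI / ((2 * INR p + 1) ^ 2 * cbin p ^ 2)))
      by ring.
    unfold P; field; repeat split; lra.
Qed.

(** [(1 - z) * (2 E - K) / (PI / 2)] for the parameter [z], continuous up to [z = 1]
    unlike [2 E - K]. *)
Definition damped_2EK (z : R) : R := (1 - 2 * z) * damped_U0 z + 4 * (1 - z) * damped_U1 z.

Lemma continuous_damped_2EK z : continuous damped_2EK z.
Proof.
assert (C0 := continuous_damped_U0); assert (C1 := continuous_damped_U1).
unfold damped_2EK; continuous_R.
Qed.

(** With [p = n + 1], integrating the term in [u'] by parts turns the integral of
    [(1 - z) ^ p (2 E - K)] into [(4 p + 3) M_p - (4 p + 6) M_(p + 1)], where [M_p] is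
    the moment of [u]; the recurrence then leaves [M_p (2 p + 1) / (2 p + 3)]. *)
Lemma damped_2EK_antiderivative n :
  exists G : R -> R,
    (forall z, continuous G z) /\
    (forall z, 0 < z < 1 -> is_derive G z ((1 - z) ^ n * damped_2EK z)) /\
    G 1 - G 0 = 4 / PI * (2 * INR n + 2) ^ 2
      / (cbin n ^ 2 * ((2 * INR n + 1) ^ 2 * (2 * INR n + 3) * (2 * INR n + 5))).
Proof.
assert (HPI := PI_RGT_0).
destruct (moment_antiderivative (S n)) as (H & Hc & Hd & H0 & H1).
destruct (moment_antiderivative (S (S n))) as (K & Kc & Kd & K0 & K1).
set (p := INR (S n)) in *.
exists (fun z => (4 * p + 3) * H z - (4 * p + 6) * K z + 4 * z * (1 - z) ^ S n * damped_U0 z).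
split; [| split].
- intros z; assert (C0 := continuous_damped_U0); continuous_R.
- intros z Hz.
  apply (is_derive_ext_loc (fun z => (4 * p + 3) * H z - (4 * p + 6) * K z
           + 4 * z * (1 - z) ^ S (S n) * U0 z)).
  { apply (filter_imp (fun y => -1 < y < 1)); [| apply locally_between; lra].
    intros y Hy; rewrite (damped_U0_eq y Hy).
    change ((1 - y) ^ S (S n)) with ((1 - y) * (1 - y) ^ S n).
    change ((4 * p + 3) * H y - (4 * p + 6) * K y + 4 * y * ((1 - y) * (1 - y) ^ S n) * U0 y
      = (4 * p + 3) * H y - (4 * p + 6) * K y + 4 * y * (1 - y) ^ S n * ((1 - y) * U0 y)).
    ring. }
  evar_last.
  { apply (is_derive_plus (fun z => (4 * p + 3) * H z - (4 * p + 6) * K z)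
             (fun z => 4 * z * (1 - z) ^ S (S n) * U0 z)).
    - apply (is_derive_minus (fun z => (4 * p + 3) * H z) (fun z => (4 * p + 6) * K z)).
      + now apply (is_derive_scal H), Hd.
      + now apply (is_derive_scal K), Kd.
    - apply (is_derive_mult (fun z => 4 * z * (1 - z) ^ S (S n)) U0);
        [| apply is_derive_U0; [apply Rabs_lt_1 |]; lra | exact Rmult_comm].
      auto_derive; [easy | reflexivity]. }
  unfold damped_2EK; rewrite damped_U0_eq, damped_U1_eq by lra.
  unfold plus, minus, opp, mult; simpl; unfold plus, Rminus; simpl.
  change (match n with 0%nat => 1 | S _ => INR n + 1 end) with p.
  field; lra.
- rewrite H0, H1, K0, K1, damped_U0_at_1; unfold p; rewrite !cbin_S, !S_INR.
  generalize (pos_INR n) (cbin_bounds n); intros.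
  rewrite !Rmult_0_r, Rmult_0_l; field; repeat split; lra.
Qed.

Lemma is_RInt_damped_2EK n :
  is_RInt (fun y => y * (1 - y ^ 2) ^ n * damped_2EK (y ^ 2)) 0 1
    (2 / PI * (2 * INR n + 2) ^ 2
      / (cbin n ^ 2 * ((2 * INR n + 1) ^ 2 * (2 * INR n + 3) * (2 * INR n + 5)))).
Proof.
assert (HPI := PI_RGT_0).
destruct (damped_2EK_antiderivative n) as (G & Gc & Gd & E).
assert (Cc : forall (f : R -> R) x, (forall z, continuous f z) -> continuous (fun y => f (y ^ 2)) x).
{ intros f x Hf; apply (continuous_comp (fun y => y ^ 2) f); [| apply Hf].
  apply (ex_derive_continuous (fun y => y ^ 2)); auto_derive; easy. }
evar_last.
- apply (is_RInt_antiderivative (fun y => / 2 * G (y ^ 2))); [lra | | |].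
  + intros y Hy.
    replace (_ * damped_2EK (y ^ 2)) with (/ 2 * (2 * y * ((1 - y ^ 2) ^ n * damped_2EK (y ^ 2))))
      by field.
    apply (is_derive_scal (fun y => G (y ^ 2))), (is_derive_comp G (fun y => y ^ 2)).
    * apply Gd; simpl; nra.
    * auto_derive; [easy | ring].
  + intros y _; apply (continuous_mult (fun _ => / 2) (fun y => G (y ^ 2)));
      [apply continuous_const | now apply Cc].
  + intros y; apply (continuous_mult (fun y => y * (1 - y ^ 2) ^ n) (fun y => damped_2EK (y ^ 2))).
    * apply (ex_derive_continuous (fun y => y * (1 - y ^ 2) ^ n)); auto_derive; easy.
    * apply Cc, continuous_damped_2EK.
- rewrite pow1, pow_i by lia.
  transitivity (/ 2 * (G 1 - G 0)); [ring |]; rewrite E.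
  generalize (pos_INR n) (cbin_bounds n); intros; field; repeat split; lra.
Qed.

Lemma cps_bounded c : abs_summable c -> exists B, forall x, Rabs (cps c x) <= B.
Proof.
intros Hc; exists (Series (fun n => Rabs (c n))); intros x; unfold cps, PSeries.
assert (Hb : forall n, Rabs (c n * clamp x ^ n) <= Rabs (c n)).
{ intros n; apply Rabs_mult_pow_le, clamp_bound. }
eapply Rle_trans; [apply Series_Rabs |].
- apply (ex_series_le (K := R_AbsRing) (V := R_CompleteNormedModule) _
    (fun n => Rabs (c n))); [| easy].
  intros n; unfold norm; simpl; unfold abs; simpl; now rewrite Rabs_Rabsolu.
- apply Series_le; [| easy]; intros n; split; [apply Rabs_pos | apply Hb].
Qed.

Lemma damped_2EK_bounded : exists B, forall z, 0 <= z <= 1 -> Rabs (damped_2EK z) <= B.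
Proof.
destruct (cps_bounded _ abs_summable_damped_U0) as [A HA].
destruct (cps_bounded _ abs_summable_damped_U1) as [B HB].
exists (A + 4 * B); intros z Hz; specialize (HA z); specialize (HB z).
fold damped_U0 in HA; fold damped_U1 in HB; unfold damped_2EK.
apply Rabs_le_between in HA; apply Rabs_le_between in HB.
apply Rabs_le; split; nra.
Qed.

(** * The integrals as binomial series *)

Definition paramK (z : R) : R := RInt (fun x => / sqrt (1 - z * sin x ^ 2)) 0 (PI / 2).
Definition paramE (z : R) : R := RInt (fun x => sqrt (1 - z * sin x ^ 2)) 0 (PI / 2).

Lemma paramK_eq z : Rabs z < 1 -> paramK z = PI / 2 * U0 z.
Proof.
intros Hz; apply (is_RInt_unique (V := R_CompleteNormedModule)); now apply is_RInt_K.
Qed.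

Lemma paramE_eq z : Rabs z < 1 -> paramE z = PI / 2 * ((1 - z) * (U0 z + 2 * U1 z)).
Proof.
intros Hz; apply (is_RInt_unique (V := R_CompleteNormedModule)); now apply is_RInt_E.
Qed.

(** What remains of the [n]-th term once the moment of [2 E - K] has cancelled two
    of the three factors [cbin n] of Clausen's series. *)
Definition weight (n : nat) : R :=
  (2 * INR n + 2) ^ 2 / ((2 * INR n + 1) ^ 2 * (2 * INR n + 3) * (2 * INR n + 5)).

Lemma ex_series_cbin3 : ex_series cbin3.
Proof.
apply (ex_series_le (K := R_AbsRing) (V := R_CompleteNormedModule) _
  (fun n => 2 * (cbin n / (2 * INR n + 1)))).
- intros n; change (Rabs (cbin3 n) <= 2 * (cbin n / (2 * INR n + 1))).
  generalize (cbin_bounds n) (cbin_sqr_le n) (pos_INR n); intros H1 H2 H3.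
  unfold cbin3; rewrite Rabs_pos_eq by (apply pow_le; lra).
  replace (cbin n ^ 3) with (cbin n * cbin n ^ 2) by ring.
  replace (2 * (cbin n / (2 * INR n + 1))) with (cbin n * / (INR n + / 2)) by (field; lra).
  apply Rmult_le_compat_l; [lra |]; apply Rle_trans with (1 := H2).
  apply Rinv_le_contravar; lra.
- apply (ex_series_scal (V := R_NormedModule) 2), ex_series_cbin.
Qed.

(** Clausen's series in [x (1 - y ^ 2)] is dominated by [sum cbin n ^ 3] uniformly
    in [y], also for [x = 1], and the factor [1 - y ^ 2] tames [2 E - K] at [y = 1]; so
    the integration may be done term by term. *)
Lemma is_RInt_cubic (x : R) (zf : R -> R) :
  -1 <= x <= 1 ->
  (forall y, 0 < y < 1 ->
     -1 / 5 < zf y < 1 / 2 /\ clausen_arg (zf y) = x * (1 - y ^ 2)) ->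
  is_RInt (fun y => y * (1 - y ^ 2) * paramK (zf y) ^ 2
                    * (2 * paramE (y ^ 2) - paramK (y ^ 2))) 0 1
    (PI ^ 2 / 4 * Series (fun n => cbin n * weight n * x ^ n)).
Proof.
intros Hx Hzf; assert (HPI := PI_RGT_0).
destruct damped_2EK_bounded as [B HB].
rewrite <- Series_scal_l.
rewrite (Series_ext _ (fun n => PI ^ 3 / 8 * cbin3 n * x ^ n *
  (2 / PI * (2 * INR n + 2) ^ 2
      / (cbin n ^ 2 * ((2 * INR n + 1) ^ 2 * (2 * INR n + 3) * (2 * INR n + 5)))))).
2:{ intros n; unfold weight, cbin3; generalize (pos_INR n) (cbin_bounds n); intros.
    field; repeat split; lra. }
apply (is_RInt_series
  (fun n y => PI ^ 3 / 8 * cbin3 n * x ^ n * (y * (1 - y ^ 2) ^ n * damped_2EK (y ^ 2)))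
  _ _ (fun n => PI ^ 3 / 8 * B * cbin3 n)); [lra | | | |].
- intros n; apply (is_RInt_scal (V := R_NormedModule)), is_RInt_damped_2EK.
- apply (ex_series_scal (V := R_NormedModule) (PI ^ 3 / 8 * B)), ex_series_cbin3.
- intros n y Hy.
  assert (HP : 0 < PI ^ 3 / 8) by (apply Rdiv_lt_0_compat; [apply pow_lt |]; lra).
  assert (Hc : 0 <= cbin3 n) by (apply pow_le; generalize (cbin_bounds n); lra).
  specialize (HB (y ^ 2) ltac:(simpl; nra)).
  replace (PI ^ 3 / 8 * cbin3 n * x ^ n * (y * (1 - y ^ 2) ^ n * damped_2EK (y ^ 2)))
    with (PI ^ 3 / 8 * cbin3 n * ((y * (x * (1 - y ^ 2)) ^ n) * damped_2EK (y ^ 2)))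
    by (rewrite Rpow_mult_distr; ring).
  replace (PI ^ 3 / 8 * B * cbin3 n) with (PI ^ 3 / 8 * cbin3 n * B) by ring.
  assert (HPc : 0 <= PI ^ 3 / 8 * cbin3 n) by (apply Rmult_le_pos; lra).
  rewrite Rabs_mult, (Rabs_pos_eq (_ * cbin3 n)) by easy.
  apply Rmult_le_compat_l; [easy |].
  rewrite Rabs_mult, <- (Rmult_1_l B).
  apply Rmult_le_compat; try apply Rabs_pos; [| easy].
  assert (0 <= 1 - y ^ 2 <= 1) by (simpl; nra).
  eapply Rle_trans; [apply Rabs_mult_pow_le; split; nra |].
  rewrite Rabs_pos_eq; lra.
- intros y Hy; destruct (Hzf y Hy) as [Hz E].
  assert (Hy2 : -1 < y ^ 2 < 1) by (simpl; nra).
  rewrite !paramK_eq, paramE_eq by (apply Rabs_lt_1; lra).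
  replace (_ * (2 * _ - _))
    with (PI ^ 3 / 8 * (y * damped_2EK (y ^ 2)) * U0 (zf y) ^ 2)
    by (unfold damped_2EK; rewrite damped_U0_eq, damped_U1_eq by easy; field).
  rewrite clausen, E by easy.
  apply (is_series_ext (fun n => scal (PI ^ 3 / 8 * (y * damped_2EK (y ^ 2)))
                                   (cbin3 n * (x * (1 - y ^ 2)) ^ n))).
  + intros n; unfold scal; simpl; unfold mult; simpl.
    rewrite Rpow_mult_distr; simpl; ring.
  + apply (is_series_scal (V := R_NormedModule)).
    apply unit_radius_is_series; [apply unit_radius_cbin3 |].
    rewrite <- E; now apply clausen_arg_bound.
Qed.

(** Partial fractions of [weight n] in [2 n + 1]. *)
Lemma Series_weight (eps t : R) :
  t <> 0 -> -1 <= eps * t ^ 2 <= 1 ->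
  t * Series (fun n => cbin n * weight n * (eps * t ^ 2) ^ n)
  = arcsine_dilog eps t / 8 + 5 / 32 * series_primitive 2 1 cbin eps t
    + series_primitive 2 3 cbin eps t / (8 * t ^ 2)
    - 9 / 32 * series_primitive 2 5 cbin eps t / t ^ 4.
Proof.
intros Ht Hx; unfold arcsine_dilog, series_primitive; set (x := eps * t ^ 2) in *.
assert (Hj : forall j, (1 <= j)%nat ->
  is_series (fun n => integrated 2 j cbin n * x ^ n) (cps (integrated 2 j cbin) x)).
{ intros j Hj; apply cps_is_series; [now apply abs_summable_cbin | easy]. }
assert (H0 : is_series (fun n => integrated 2 1 (integrated 2 1 cbin) n * x ^ n)
               (cps (integrated 2 1 (integrated 2 1 cbin)) x)).
{ apply cps_is_series; [| easy].
  now apply abs_summable_integrated, abs_summable_cbin. }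
assert (E : is_series (fun n => cbin n * weight n * x ^ n)
  (/ 8 * cps (integrated 2 1 (integrated 2 1 cbin)) x
   + (5 / 32 * cps (integrated 2 1 cbin) x
      + (/ 8 * cps (integrated 2 3 cbin) x + - 9 / 32 * cps (integrated 2 5 cbin) x)))).
{ eapply is_series_ext;
    [| apply (is_series_plus (V := R_NormedModule) _ _ _ _
         (is_series_scal (V := R_NormedModule) (/ 8) _ _ H0)
         (is_series_plus (V := R_NormedModule) _ _ _ _
            (is_series_scal (V := R_NormedModule) (5 / 32) _ _ (Hj 1%nat ltac:(lia)))
            (is_series_plus (V := R_NormedModule) _ _ _ _
              (is_series_scal (V := R_NormedModule) (/ 8) _ _ (Hj 3%nat ltac:(lia)))
              (is_series_scal (V := R_NormedModule) (- 9 / 32) _ _ (Hj 5%nat ltac:(lia))))))].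
  intros n; unfold plus, scal; simpl; unfold mult; simpl.
  unfold integrated, weight; simpl INR; generalize (pos_INR n); intros.
  field; repeat split; lra. }
rewrite (is_series_unique _ _ E); field; easy.
Qed.

Lemma ellipticK_paramK k z : Re (k ^ 2)%C = z -> ellipticK k = paramK z.
Proof. now intros <-. Qed.

Lemma ellipticE_paramE k z : Re (k ^ 2)%C = z -> ellipticE k = paramE z.
Proof. now intros <-. Qed.

Lemma Re_sqrtC_sqr x : Re (sqrtC x ^ 2)%C = x.
Proof.
unfold sqrtC, Re; simpl.
destruct (Rle_lt_dec 0 x) as [Hx | Hx].
- rewrite (sqrt_neg_0 (- x)) by lra; generalize (sqrt_sqrt x Hx); lra.
- rewrite (sqrt_neg_0 x) by lra; generalize (sqrt_sqrt (- x) ltac:(lra)); lra.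
Qed.

Lemma Re_sqrtC_half_sqr x : Re ((sqrtC x / RtoC 2) ^ 2)%C = x / 4.
Proof.
replace ((sqrtC x / RtoC 2) ^ 2)%C with (RtoC (/ 4) * sqrtC x ^ 2)%C.
- transitivity (/ 4 * Re (sqrtC x ^ 2)%C); [| rewrite Re_sqrtC_sqr; field].
  unfold Re; simpl; ring.
- replace (RtoC (/ 4)) with (/ RtoC 2 * / RtoC 2)%C.
  + unfold Cdiv; simpl; ring.
  + rewrite <- RtoC_inv by lra; rewrite <- RtoC_mult; f_equal; field.
Qed.

Lemma Re_RtoC_sqr y : Re (RtoC y ^ 2)%C = y ^ 2.
Proof. unfold Re; simpl; ring. Qed.

Lemma is_RInt_ellipticK (k : R -> C) (zf : R -> R) (x v : R) :
  -1 <= x <= 1 ->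
  (forall y, Re (k y ^ 2)%C = zf y) ->
  (forall y, 0 < y < 1 ->
     -1 / 5 < zf y < 1 / 2 /\ clausen_arg (zf y) = x * (1 - y ^ 2)) ->
  PI ^ 2 / 4 * Series (fun n => cbin n * weight n * x ^ n) = v ->
  is_RInt (fun y => y * (1 - y ^ 2) * ellipticK (k y) ^ 2
                    * (2 * ellipticE (RtoC y) - ellipticK (RtoC y))) 0 1 v.
Proof.
intros Hx Hk Hzf <-.
eapply is_RInt_ext; [| apply (is_RInt_cubic x zf); easy].
intros y _; simpl.
rewrite (ellipticK_paramK _ _ (Hk y)), (ellipticK_paramK _ _ (Re_RtoC_sqr y)),
  (ellipticE_paramE _ _ (Re_RtoC_sqr y)).
reflexivity.
Qed.

Theorem corollary5 :
  is_RInt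
    (fun y : R =>
       y * (1 - y ^ 2) * ellipticK (sqrtC (1 / 2 - y / 2)) ^ 2
       * (2 * ellipticE (RtoC y) - ellipticK (RtoC y)))
    0 1
    (PI ^ 3 * (29 + 32 * ln 2) / 2048)
  /\
  is_RInt
    (fun y : R =>
       y * (1 - y ^ 2)
       * ellipticK (sqrtC (2 - sqrt 2 * sqrt (y ^ 2 + 1)) / RtoC 2)%C ^ 2
       * (2 * ellipticE (RtoC y) - ellipticK (RtoC y)))
    0 1
    (PI ^ 2 * catalan / (32 * sqrt 2) + 7 * PI ^ 2 / (64 * sqrt 2)
     - 9 * PI ^ 3 / (512 * sqrt 2) + PI ^ 3 * ln 2 / (128 * sqrt 2))
  /\
  is_RInt
    (fun y : R =>
       y * (1 - y ^ 2)
       * ellipticK (sqrtC (2 - sqrt (5 - y ^ 2)) / RtoC 2)%C ^ 2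
       * (2 * ellipticE (RtoC y) - ellipticK (RtoC y)))
    0 1
    (- (57 / 64) * PI ^ 2 * ln golden_ratio + PI ^ 4 / 320
     + 53 * sqrt 5 * PI ^ 2 / 256).
Proof.
assert (HPI := PI_RGT_0).
split; [| split].
- (* here [x = t ^ 2] with [t = sin (PI / 2)] *)
  apply (is_RInt_ellipticK _ (fun y => 1 / 2 - y / 2) 1); [lra | | |].
  + intros y; apply Re_sqrtC_sqr.
  + intros y Hy; split; [lra |]; unfold clausen_arg; field.
  + assert (E := Series_weight 1 (sin (PI / 2)) ltac:(rewrite sin_PI2; lra)
                   ltac:(rewrite sin_PI2; simpl; lra)).
    rewrite series_primitive_cbin_sin_1, series_primitive_cbin_sin_3,
      series_primitive_cbin_sin_5 in E by lra.
    rewrite cos_PI2, sin_PI2, arcsine_dilog_1, pow1, !Rmult_1_l in E.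
    rewrite E; field.
- (* here [x = t ^ 2] with [t = sin (PI / 4)] *)
  assert (H2 : 0 < sqrt 2) by (apply sqrt_lt_R0; lra).
  assert (H22 : sqrt 2 * sqrt 2 = 2) by (apply sqrt_sqrt; lra).
  apply (is_RInt_ellipticK _ (fun y => (2 - sqrt 2 * sqrt (y ^ 2 + 1)) / 4) (1 / 2));
    [lra | | |].
  + intros y; apply Re_sqrtC_half_sqr.
  + intros y Hy.
    rewrite <- sqrt_mult by (simpl; nra).
    set (q := sqrt (2 * (y ^ 2 + 1))).
    assert (Hq : q * q = 2 * (y ^ 2 + 1)) by (apply sqrt_sqrt; simpl; nra).
    assert (Hq0 : 0 <= q) by apply sqrt_pos.
    unfold clausen_arg; simpl in *; split; nra.
  + assert (E := Series_weight 1 (sin (PI / 4))).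
    rewrite arcsine_dilog_sin_PI4, series_primitive_cbin_sin_1, series_primitive_cbin_sin_3,
      series_primitive_cbin_sin_5 in E by lra.
    rewrite sin_PI4, cos_PI4 in E.
    replace (1 * (1 / sqrt 2) ^ 2) with (1 / 2) in E
      by (transitivity (1 / (sqrt 2 * sqrt 2)); [now rewrite H22 | field; lra]).
    specialize (E ltac:(apply Rgt_not_eq, Rdiv_lt_0_compat; lra) ltac:(lra)).
    set (S := Series _) in *.
    assert (ES : S = sqrt 2 * (1 / sqrt 2 * S)) by (field; lra).
    rewrite ES, E.
    apply Rmult_eq_reg_r with (sqrt 2); [| lra].
    field_simplify; [| lra ..].
    replace (sqrt 2 ^ 6) with ((sqrt 2 * sqrt 2) ^ 3) by ring.
    replace (sqrt 2 ^ 4) with ((sqrt 2 * sqrt 2) ^ 2) by ring.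
    replace (sqrt 2 ^ 2) with (sqrt 2 * sqrt 2) by ring.
    rewrite H22; field.
- (* here [x = - t ^ 2] with [t = sinh (ln golden_ratio)] *)
  set (L := ln golden_ratio).
  assert (Hb := golden_ratio_bounds).
  assert (HL : 0 <= L) by (unfold L; rewrite <- ln_1; apply Rlt_le, ln_increasing; lra).
  assert (HsL := sinh_ln_golden_ratio); fold L in HsL.
  assert (H5 : 0 < sqrt 5) by (apply sqrt_lt_R0; lra).
  assert (H55 : sqrt 5 * sqrt 5 = 5) by (apply sqrt_sqrt; lra).
  apply (is_RInt_ellipticK _ (fun y => (2 - sqrt (5 - y ^ 2)) / 4) (-1 / 4));
    [lra | | |].
  + intros y; apply Re_sqrtC_half_sqr.
  + intros y Hy.
    set (q := sqrt (5 - y ^ 2)).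
    assert (Hq : q * q = 5 - y ^ 2) by (apply sqrt_sqrt; simpl; nra).
    assert (Hq0 : 0 <= q) by apply sqrt_pos.
    unfold clausen_arg; simpl in *; split; nra.
  + assert (HcL : cosh L = sqrt 5 / 2).
    { assert (C := cosh_sqr L); rewrite HsL in C.
      assert (0 < cosh L) by (unfold cosh; generalize (exp_pos L) (exp_pos (- L)); lra).
      nra. }
    assert (E := Series_weight (-1) (sinh L)).
    rewrite series_primitive_cbin_sinh_1, series_primitive_cbin_sinh_3,
      series_primitive_cbin_sinh_5 in E by lra.
    rewrite HsL, HcL, arcsine_dilog_half in E.
    replace (-1 * (1 / 2) ^ 2) with (-1 / 4) in E by field.
    specialize (E ltac:(lra) ltac:(lra)).
    set (S := Series _) in *.
    replace S with (2 * (1 / 2 * S)) by field.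
    rewrite E; field.
Qed.
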